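(* Let $f:\mathbb{R}^d\to\mathbb{R}$ be differentiable and bounded below, with $f^*:=\inf f$, and suppose $\|\nabla f(w)-\nabla f(w')\|\le L\|w-w'\|$ for all $w,w'\in\mathbb{R}^d$. Let $\eta>0$, and let $(w_t)_{t\ge1}$, $(\nu_t)_{t\ge0}$, $(g_t)_{t\ge1}$ be generated by AdaGrad-Norm (see context) with learning rate $\eta$, initial point $w_1\in\mathbb{R}^d$ and initial conditioner $\nu_0>0$, where the stochastic gradients satisfy, for all $t\ge1$, $\mathbb{E}[g_t\mid\mathcal{F}_t]=\nabla f(w_t)$ and $$\mathbb{E}[\|g_t\|^2\mid\mathcal{F}_t]\le D_0+D_1\|\nabla f(w_t)\|^2$$ for constants $D_0\ge0$, $D_1>0$. Then for every $\delta\in(0,1)$ and every integer $T\ge1$, with probability at least $1-\delta$, $$\min_{1\le t\le T}\|\nabla f(w_t)\|^2\le\frac{2\sqrt{2D_0}\,\bigl(2C_2\ln(2\sqrt{2D_0T}+C_3)+C_1\bigr)}{\sqrt{T}\,\delta^2}+\frac{C_3\bigl(C_1+2C_2\ln(2\sqrt{2D_0T}+C_3)\bigr)}{T\delta^2},$$ where $$C_1:=\frac{4}{\eta}\Bigl(f(w_1)-f^*+\frac{\eta D_1}{2}\frac{\|\nabla f(w_0)\|^2}{\sqrt{\nu_0}}+\bigl(2\eta(L\eta D_1)^2+\eta D_1(L\eta)^2+\tfrac{\eta}{2}D_0\bigr)\frac{1}{\sqrt{\nu_0}}-\frac{L}{2}\eta^2\ln\nu_0\Bigr),$$ $C_2:=2L\eta$,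 $C_3:=4D_1C_1+48C_2D_1\ln(4C_2D_1+e)+2\sqrt{\nu_0}$, and by convention $w_0:=w_1$.
   Context: AdaGrad-Norm: given an objective $f:\mathbb{R}^d\to\mathbb{R}$, a learning rate $\eta>0$, a (deterministic) initial point $w_1\in\mathbb{R}^d$ and a (deterministic) initial conditioner $\nu_0\in(0,\infty)$, for $t=1,2,\dots$ one obtains a random vector (stochastic gradient) $g_t\in\mathbb{R}^d$ and sets $$\nu_t=\nu_{t-1}+\|g_t\|^2,\qquad w_{t+1}=w_t-\eta\,\frac{g_t}{\sqrt{\nu_t}}.$$ $\mathcal{F}_t:=\sigma(g_1,\dots,g_{t-1})$ is the sigma-field generated by the stochastic gradients up to time $t-1$ (so $w_t$ and $\nu_{t-1}$ are $\mathcal{F}_t$-measurable). $\|\cdot\|$ is the Euclidean norm. *)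

(* Defs.v *)
From HB Require Import structures.
From mathcomp Require Import all_boot all_order all_algebra.
From mathcomp Require Import all_classical all_reals all_analysis.
From mathcomp Require Import measurable_realfun.
Set Implicit Arguments.
Unset Strict Implicit.
Unset Printing Implicit Defensive.
Import Order.TTheory GRing.Theory Num.Theory.
Import numFieldNormedType.Exports.
Local Open Scope classical_set_scope.
Local Open Scope ring_scope.

(* The library norm `|v| on 'rV[R]_n is the sup norm, hence this definition. *)
Definition enorm (R : realType) (n : nat) (v : 'rV[R]_n) : R :=
  Num.sqrt (\sum_(i < n) v 0 i ^+ 2).

Definition grad (R : realType) (n : nat) (f : 'rV[R]_n -> R) (w : 'rV[R]_n) :
    'rV[R]_n :=
  \row_(i < n) 'D_(delta_mx 0 i) f w.

(* Indices follow the mathematical convention: nu starts at 0, while g and w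
   start at 1; the values g 0 and w 0 are never used. *)
Definition adagrad_norm (R : realType) (n : nat) (Omega : Type)
    (eta nu0 : R) (w1 : 'rV[R]_n)
    (g w : nat -> Omega -> 'rV[R]_n) (nu : nat -> Omega -> R) : Prop :=
  forall x : Omega,
    [/\ nu 0%N x = nu0,
        w 1%N x = w1,
        forall t : nat, (1 <= t)%N ->
          nu t x = nu t.-1 x + enorm (g t x) ^+ 2
      & forall t : nat, (1 <= t)%N ->
          w t.+1 x = w t x - (eta / Num.sqrt (nu t x)) *: g t x].

(* Random vectors are measured through their coordinates: the Borel
   sigma-algebra of R^n is the product one. *)
Definition random_vector (R : realType) (n : nat) (disp : measure_display)
    (Omega : measurableType disp) (X : Omega -> 'rV[R]_n) : Prop :=
  forall i : 'I_n, measurable_fun [set: Omega] (fun x => X x 0 i).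

(* sigma(g_1, ..., g_(t-1)) *)
Definition past (R : realType) (n : nat) (Omega : Type)
    (g : nat -> Omega -> 'rV[R]_n) (t : nat) : set (set Omega) :=
  <<s [set A | exists s (i : 'I_n), (1 <= s < t)%N /\
         preimage_set_system [set: Omega] (fun x => g s x 0 i) measurable A] >>.

(* Y is a version of E[X | G]. The conditional expectation is defined for X
   integrable, or X measurable and nonnegative (then it may take the value
   +oo). In both cases the remaining clauses imply that Y is integrable, resp.
   almost surely nonnegative. *)
Definition is_cond_expectation (R : realType) (disp : measure_display)
    (Omega : measurableType disp) (P : probability Omega R)
    (G : set (set Omega)) (X Y : Omega -> \bar R) : Prop :=
  [/\ P.-integrable [set: Omega] X \/
        (measurable_fun [set: Omega] X /\ forall x, (0 <= X x)%E),
      preimage_set_system [set: Omega] Y measurable `<=` G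
    & forall A, G A ->
        (\int[P]_(x in A) Y x = \int[P]_(x in A) X x)%E].

(* Main.v *)
Require Import Defs.
From HB Require Import structures.
From mathcomp Require Import all_boot all_order all_algebra.
From mathcomp Require Import all_classical all_reals all_analysis.
From mathcomp Require Import measurable_realfun.
From mathcomp Require Import ring lra zify.
Set Implicit Arguments.
Unset Strict Implicit.
Unset Printing Implicit Defensive.
Import Order.TTheory GRing.Theory Num.Theory.
Import numFieldNormedType.Exports.
Local Open Scope classical_set_scope.
Local Open Scope ring_scope.

(* Write r_t = sqrt(nu_t) and G_t = |grad f (w_t)|. The descent lemma bounds the
   sum of <grad f (w_t), g_t> / r_t along every trajectory. Replacing r_t by
   the F_t-measurable r_(t-1) costs an error that telescopes: it is controlled
   by (D0 + D1 G_t^2) (1 / r_(t-1) - 1 / r_t), and G_t moves slowly because the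
   steps of the algorithm are short. Taking expectations, B = E[sum G_t^2 /
   r_(t-1)] is at most C1 + C2 E[ln nu_T], hence at most C1 + 2 C2 ln E[r_T].
   Conversely, splitting |g_t|^2 with the weights D0 / (D0 + D1 G_t^2) and
   D1 G_t^2 / (D0 + D1 G_t^2) gives E[r_T] <= sqrt(nu_0 + D0 T) + D1 B.
   The two bounds together make E[r_T] at most 2 sqrt(2 D0 T) + C3. Finally
   T min G_t^2 <= r_T * sum G_t^2 / r_(t-1), and Markov's inequality is applied
   to the square root of this product.
   All variables are integrable because the steps have length at most eta, so
   that G_t is bounded for each t. *)

(** * Scalar inequalities *)

Lemma le_young_weighted (R : realFieldType) (a b c : R) : 0 < c ->
  2 * (a * b) <= a ^+ 2 / c + c * b ^+ 2.
Proof.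
move=> c0; rewrite -subr_ge0.
have -> : a ^+ 2 / c + c * b ^+ 2 - 2 * (a * b) = (a - c * b) ^+ 2 / c.
  by field; rewrite gt_eqF.
by rewrite divr_ge0 ?sqr_ge0 // ltW.
Qed.

(* Replaces the conditional Cauchy-Schwarz inequality by a pathwise one: the
   middle term of the right-hand side is bounded, after conditioning, by
   [G ^+ 2 / s]. *)
Lemma surrogate_error (R : realFieldType) (D0 D1 s r G p ip : R) :
  0 <= D0 -> 0 < D1 -> 0 < s -> s <= r -> 0 <= G -> 0 <= p ->
  `|ip| <= G * p ->
  ip / s <= ip / r + 2^-1 * (G ^+ 2 * p ^+ 2 / ((D0 + D1 * G ^+ 2) * s))
            + 2^-1 * ((D0 + D1 * G ^+ 2) * (1 / s - 1 / r)).
Proof.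
move=> D0ge D1gt s0 sr G0 p0 hip; have r0 : 0 < r := lt_le_trans s0 sr.
set W := D0 + D1 * G ^+ 2.
have q0 : 0 <= 1 / s - 1 / r by rewrite subr_ge0 !div1r lef_pV2 ?posrE.
have W0 : 0 <= W by rewrite addr_ge0 // mulr_ge0 ?sqr_ge0 // ltW.
have h1 : ip / s - ip / r <= G * p * (1 / s - 1 / r).
  have -> : ip / s - ip / r = ip * (1 / s - 1 / r) by field; rewrite !gt_eqF.
  by apply: ler_wpM2r => //; apply: le_trans hip; exact: ler_norm.
(* Young's inequality needs a positive weight. If [W] vanishes then [G] vanishes too, and so does
   the error bound [h1]. *)
have [W00|Wn0] := eqVneq W 0.
  have G00 : G = 0.
    have : D1 * G ^+ 2 = 0.
      by have := mulr_ge0 (ltW D1gt) (sqr_ge0 G); move: W00; rewrite /W; lra.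
    by move/eqP; rewrite mulf_eq0 gt_eqF //= sqrf_eq0 => /eqP.
  move: h1; rewrite W00 G00; rewrite !mul0r !expr0n /= !mul0r !mulr0; lra.
have Wp : 0 < W by rewrite lt_def Wn0.
(* This inequality gets multiplied by [1 / s - 1 / r]. In the term with [p], the subtracted [1 / r]
   is then dropped. *)
have h2 := @le_young_weighted R (G * p) 1 W Wp.
have h3 : (G * p) ^+ 2 / W * (1 / s - 1 / r) <= G ^+ 2 * p ^+ 2 / (W * s).
  have -> : G ^+ 2 * p ^+ 2 / (W * s) = (G * p) ^+ 2 / W * (1 / s).
    by field; rewrite !gt_eqF.
  apply: ler_wpM2l; first by rewrite divr_ge0 // sqr_ge0.
  have : 0 < 1 / r by rewrite divr_gt0.
  lra.
have h4 := ler_wpM2r q0 h2.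
lra.
Qed.

(** Changes [G] into [G'] in the telescoping term over a fixed denominator. Squaring the drift gives
    a cross term [D1 * G' * k] with [k = c * (p / s)]. The square of [G' / 2 - D1 * k] splits it
    into a quarter of [G' ^+ 2], paid by the main sum, and a term quadratic in [p]. *)
Lemma sqr_grad_drift (R : realFieldType) (c D1 s G G' p : R) :
  0 <= c -> 0 < D1 -> 0 < s -> 0 <= G -> 0 <= G' -> 0 <= p ->
  G' <= G + c * (p / s) ->
  2^-1 * (D1 * (G' ^+ 2 / s)) - 4^-1 * (G' ^+ 2 / s) <=
  2^-1 * (D1 * (G ^+ 2 / s)) + (D1 * c) ^+ 2 * (p ^+ 2 / s ^+ 3).
Proof.
move=> c0 D1gt s0 G0 G'0 p0 h.
set k := c * (p / s) in h.
have k0 : 0 <= k by rewrite mulr_ge0 // divr_ge0 // ltW.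
have h1 : G' ^+ 2 <= G ^+ 2 + 2 * (G' * k).
  (* If [G' < k], the drift cannot be squared, but then [G' ^+ 2 <= 2 * (G' * k)] holds outright. *)
  have [h2|h2] := leP k G'; last by nra.
  have : (G' - k) ^+ 2 <= G ^+ 2 by rewrite ler_sqr ?nnegrE; lra.
  nra.
have -> : (D1 * c) ^+ 2 * (p ^+ 2 / s ^+ 3) = (D1 * k) ^+ 2 / s.
  by rewrite /k; field; rewrite gt_eqF.
have -> : 2^-1 * (D1 * (G' ^+ 2 / s)) - 4^-1 * (G' ^+ 2 / s)
   = (2^-1 * (D1 * G' ^+ 2) - 4^-1 * G' ^+ 2) / s by field; rewrite gt_eqF.
have -> : 2^-1 * (D1 * (G ^+ 2 / s)) + (D1 * k) ^+ 2 / s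
   = (2^-1 * (D1 * G ^+ 2) + (D1 * k) ^+ 2) / s by field; rewrite gt_eqF.
apply: ler_wpM2r; first by rewrite invr_ge0 ltW.
have h3 := sqr_ge0 (G' / 2 - D1 * k).
have h4 := ler_wpM2l (ltW D1gt) h1.
have E : (G' / 2 - D1 * k) ^+ 2 = G' ^+ 2 / 4 - D1 * (G' * k) + (D1 * k) ^+ 2 by field.
rewrite E in h3.
lra.
Qed.

(** Makes the quadratic error of [sqr_grad_drift] telescope. With [r ^+ 2 - s ^+ 2] in place of
    [p ^+ 2], the gap is a quotient of products of nonnegative factors. *)
Lemma increment_div_cube (R : realFieldType) (s r p : R) :
  0 < s -> s <= r -> r ^+ 2 = s ^+ 2 + p ^+ 2 ->
  p ^+ 2 / r ^+ 3 <= 2 * (1 / s - 1 / r).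
Proof.
move=> s0 sr h; have r0 : 0 < r := lt_le_trans s0 sr.
have -> : p ^+ 2 = r ^+ 2 - s ^+ 2 by rewrite h addrAC subrr add0r.
rewrite -subr_ge0.
have -> : 2 * (1 / s - 1 / r) - (r ^+ 2 - s ^+ 2) / r ^+ 3
  = (r - s) * (r * (r - s) + (r ^+ 2 - s ^+ 2)) / (s * r ^+ 3).
  by field; rewrite !gt_eqF.
have h2 : s ^+ 2 <= r ^+ 2 by rewrite ler_sqr // nnegrE ltW.
apply: divr_ge0; last by rewrite mulr_ge0 ?exprn_ge0 ?ltW.
apply: mulr_ge0; first by rewrite subr_ge0.
by rewrite addr_ge0 ?subr_ge0 // mulr_ge0 ?subr_ge0 // ltW.
Qed.

Lemma ln_tangent (R : realType) (x m : R) : 0 < x -> 0 < m ->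
  ln x <= ln m + x / m - 1.
Proof.
move=> x0 m0.
have : -1 < x / m - 1 by have := divr_gt0 x0 m0; lra.
move/le_ln1Dx; rewrite addrC subrK ln_div ?posrE //; lra.
Qed.

(** The tangent of [ln] at [r ^+ 2], evaluated at [s ^+ 2]. It makes the second-order term of the
    descent lemma telescope. *)
Lemma increment_div_ln (R : realType) (s r p : R) :
  0 < s -> 0 < r -> r ^+ 2 = s ^+ 2 + p ^+ 2 ->
  p ^+ 2 / r ^+ 2 <= ln (r ^+ 2) - ln (s ^+ 2).
Proof.
move=> s0 r0 h.
have := @ln_tangent R (s ^+ 2) (r ^+ 2) (exprn_gt0 _ s0) (exprn_gt0 _ r0).
have -> : s ^+ 2 / r ^+ 2 = 1 - p ^+ 2 / r ^+ 2.
  have -> : s ^+ 2 = r ^+ 2 - p ^+ 2 by rewrite h addrK.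
  by field; rewrite gt_eqF.
lra.
Qed.

(** The index [i] stands for time [i + 1], so [r i] is known before the gradient of that step is
    drawn. In expectation the first term of the summand equals that of [G i ^+ 2 / r i], and the
    second is at most half of it. After the third, a quarter survives on the left. *)
Lemma adagrad_pathwise (R : realType) (eta L D0 D1 : R)
    (r G p ip fv : nat -> R) :
  0 < eta -> 0 <= L -> 0 <= D0 -> 0 < D1 ->
  (forall i, 0 < r i) -> (forall i, 0 <= G i) -> (forall i, 0 <= p i) ->
  (forall i, r i.+1 ^+ 2 = r i ^+ 2 + p i ^+ 2) ->
  (forall i, `|ip i| <= G i * p i) ->
  (forall i, G i.+1 <= G i + L * eta * (p i / r i.+1)) ->
  (forall i, fv i.+1 <= fv i - eta * (ip i / r i.+1)
                        + L / 2 * eta ^+ 2 * (p i ^+ 2 / r i.+1 ^+ 2)) ->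
  forall n,
  \sum_(i < n.+1) (ip i / r i
     - 2^-1 * (G i ^+ 2 * p i ^+ 2 / ((D0 + D1 * G i ^+ 2) * r i))
     - 4^-1 * (G i ^+ 2 / r i)) <=
  (fv 0%N - fv n.+1) / eta + L * eta / 2 * (ln (r n.+1 ^+ 2) - ln (r 0%N ^+ 2))
  + D0 / 2 * (1 / r 0%N) + D1 / 2 * (G 0%N ^+ 2 / r 0%N)
  + 2 * (L * eta * D1) ^+ 2 * (1 / r 0%N).
Proof.
move=> eta0 L0 D0ge D1gt r0 G0 p0 hr hip hG hf n.
have rS i : r i <= r i.+1.
  rewrite -ler_sqr ?nnegrE ?(ltW (r0 _)) // hr lerDl sqr_ge0 //.
have step i : ip i / r i
     - 2^-1 * (G i ^+ 2 * p i ^+ 2 / ((D0 + D1 * G i ^+ 2) * r i))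
    <= (fv i - fv i.+1) / eta
       + L * eta / 2 * (ln (r i.+1 ^+ 2) - ln (r i ^+ 2))
       + D0 / 2 * (1 / r i - 1 / r i.+1)
       + 2^-1 * (D1 * (G i ^+ 2 / r i)) - 2^-1 * (D1 * (G i ^+ 2 / r i.+1)).
  have h1 := surrogate_error D0ge D1gt (r0 i) (rS i) (G0 i) (p0 i) (hip i).
  have h2 : ip i / r i.+1 <= (fv i - fv i.+1) / eta
       + L * eta / 2 * (p i ^+ 2 / r i.+1 ^+ 2).
    have -> : (fv i - fv i.+1) / eta + L * eta / 2 * (p i ^+ 2 / r i.+1 ^+ 2)
      = (fv i - fv i.+1 + L / 2 * eta ^+ 2 * (p i ^+ 2 / r i.+1 ^+ 2)) / eta.
      by field; rewrite !gt_eqF.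
    rewrite ler_pdivlMr //; have := hf i; lra.
  have h3 := increment_div_ln (r0 i) (r0 i.+1) (hr i).
  have h4 : 0 <= L * eta / 2 by rewrite divr_ge0 // mulr_ge0 // ltW.
  have h5 := ler_wpM2l h4 h3.
  lra.
(* The induction needs the negative end terms, which are dropped right after this claim. The drift
   error stops at [r n] because it enters only from the second step on. *)
suff: \sum_(i < n.+1) (ip i / r i
     - 2^-1 * (G i ^+ 2 * p i ^+ 2 / ((D0 + D1 * G i ^+ 2) * r i))
     - 4^-1 * (G i ^+ 2 / r i)) <=
  (fv 0%N - fv n.+1) / eta + L * eta / 2 * (ln (r n.+1 ^+ 2) - ln (r 0%N ^+ 2))
  + D0 / 2 * (1 / r 0%N - 1 / r n.+1)
  + 2^-1 * (D1 * (G 0%N ^+ 2 / r 0%N)) - 2^-1 * (D1 * (G n ^+ 2 / r n.+1))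
  + 2 * (L * eta * D1) ^+ 2 * (1 / r 0%N - 1 / r n).
  have h1 : 0 <= D0 / 2 * (1 / r n.+1) by rewrite mulr_ge0 ?divr_ge0 // ltW.
  have h2 : 0 <= 2^-1 * (D1 * (G n ^+ 2 / r n.+1)).
    rewrite mulr_ge0 ?invr_ge0 // mulr_ge0 ?(ltW D1gt) //.
    exact: divr_ge0 (sqr_ge0 _) (ltW (r0 _)).
  have h3 : 0 <= 2 * (L * eta * D1) ^+ 2 * (1 / r n).
    apply: mulr_ge0; first by rewrite mulr_ge0 ?sqr_ge0.
    exact: divr_ge0 ler01 (ltW (r0 _)).
  lra.
elim: n => [|n IH].
  rewrite big_ord_recl big_ord0 addr0 subrr mulr0 addr0 /=.
  have := step 0%N.
  have : 0 <= 4^-1 * (G 0%N ^+ 2 / r 0%N).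
    rewrite mulr_ge0 ?invr_ge0 //.
    exact: divr_ge0 (sqr_ge0 _) (ltW (r0 _)).
  lra.
rewrite big_ord_recr /=.
have h1 := step n.+1.
have c0 : 0 <= L * eta by rewrite mulr_ge0 // ltW.
(* The term in [G n ^+ 2 / r n.+1] left by the induction hypothesis absorbs the one in
   [G n.+1 ^+ 2 / r n.+1] of the new step. The price is the quarter subtracted in the summand. *)
have h2 := sqr_grad_drift c0 D1gt (r0 n.+1) (G0 n) (G0 n.+1) (p0 n) (hG n).
have h3 := increment_div_cube (r0 n) (rS n) (hr n).
have h4 := ler_wpM2l (sqr_ge0 (D1 * (L * eta))) h3.
have E : D1 * (L * eta) = L * eta * D1 by rewrite mulrC.
rewrite E in h2 h4.
lra.
Qed.

(** Writes [r n ^+ 2] as [N + M], where [M] collects the weights [1 - th i]. In [M / r n] each term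
    is compared with the earlier [r i]; for [N / r n], whose square is at most [N], Young's
    inequality is used. The free parameter [k] keeps the bound linear in the squares [p i ^+ 2], so
    that expectations pass through without a square root. *)
Lemma conditioner_pathwise (R : realFieldType) (r p th : nat -> R) (k : R) :
  0 < k -> (forall i, 0 < r i) ->
  (forall i, r i.+1 ^+ 2 = r i ^+ 2 + p i ^+ 2) ->
  (forall i, 0 <= th i <= 1) ->
  forall n,
  r n <= 2^-1 * ((r 0%N ^+ 2 + \sum_(i < n) th i * p i ^+ 2) / k + k)
         + \sum_(i < n) (1 - th i) * p i ^+ 2 / r i.
Proof.
move=> k0 r0 hr hth n.
have rS i : r i <= r i.+1 by rewrite -ler_sqr ?nnegrE ?(ltW (r0 _)) // hr lerDl sqr_ge0.
have rmono i j : (i <= j)%N -> r i <= r j.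
  move=> ij; rewrite -(subnK ij); elim: (j - i)%N => // m IH.
  exact: le_trans IH (rS _).
set N := _ ^+ 2 + _.
set M := \sum_(i < n) (1 - th i) * p i ^+ 2.
have E : r n ^+ 2 = N + M.
  rewrite /N /M; elim: n {N M} => [|n IH]; first by rewrite !big_ord0 !addr0.
  by rewrite hr IH !big_ord_recr /=; ring.
have M0 : 0 <= M.
  apply: sumr_ge0 => i _; rewrite mulr_ge0 ?sqr_ge0 //.
  by have /andP[] := hth i; lra.
have N0 : 0 <= N.
  rewrite addr_ge0 ?sqr_ge0 //; apply: sumr_ge0 => i _; rewrite mulr_ge0 ?sqr_ge0 //.
  by have /andP[] := hth i.
have h1 : M / r n <= \sum_(i < n) (1 - th i) * p i ^+ 2 / r i.
  rewrite /M mulr_suml; apply: ler_sum => i _; apply: ler_wpM2l.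
    rewrite mulr_ge0 ?sqr_ge0 //; by have /andP[] := hth i; lra.
  by rewrite lef_pV2 ?posrE // rmono // ltnW.
have h2 : N / r n <= 2^-1 * (N / k + k).
  have hq : (N / r n) ^+ 2 <= N.
    rewrite expr_div_n ler_pdivrMr ?exprn_gt0 // expr2; apply: ler_wpM2l => //.
    by rewrite E lerDl.
  have := le_young_weighted (N / r n) 1 k0.
  have : (N / r n) ^+ 2 / k <= N / k by rewrite ler_pM2r ?invr_gt0.
  lra.
have E2 : r n = N / r n + M / r n by rewrite -mulrDl -E expr2 mulfK // gt_eqF.
lra.
Qed.

(* Solves [X <= A + a * ln X]: the tangent of [ln] at [2 * a] absorbs half
   of [X]. *)
Lemma le_of_log_growth (R : realType) (X A a : R) : 0 < X -> 0 <= a ->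
  X <= A + a * ln X -> X <= 2 * A + 12 * a * ln (a + expR 1).
Proof.
move=> X0 a0 h.
have e1 : 1 <= expR 1 :> R by rewrite -[leLHS]expR0 ler_expR.
have e2 : 2 <= expR 1 :> R by have := expR_ge1Dx (1 : R); lra.
have ln1 : 1 <= ln (a + expR 1).
  rewrite -[leLHS]expRK ler_ln ?posrE ?expR_gt0 // ?lerDr //.
  by rewrite ltr_wpDl ?expR_gt0.
have [a00|an0] := eqVneq a 0; first by move: h X0; rewrite a00 !mul0r mulr0; lra.
have ap : 0 < a by rewrite lt_def an0.
have a2 : 0 < 2 * a by rewrite mulr_gt0.
have h1 := ln_tangent X0 a2.
have h2 : ln (2 * a) <= ln 2 + ln (a + expR 1).
  rewrite lnM ?posrE // lerD2l ler_ln ?posrE ?ltr_wpDl ?expR_gt0 //.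
  by rewrite lerDl; lra.
have h3 : ln 2 <= 1 :> R.
  by rewrite -[leRHS]expRK ler_ln ?posrE ?expR_gt0.
have h4 := ler_wpM2l a0 (le_trans h1 (lerB (lerD h2 (lexx (X / (2 * a)))) (lexx 1))).
have E : a * (X / (2 * a)) = X / 2 by field; rewrite gt_eqF.
have h5 : a * (ln 2 + ln (a + expR 1) - 1) <= a * ln (a + expR 1).
  by apply: ler_wpM2l => //; lra.
(* The tangent gives the factor 2 in front of this nonnegative term, hence also 12. With
   [a = 4 * C2 * D1] the factor 12 becomes the 48 of [C3]. *)
have h6 : 0 <= a * ln (a + expR 1) by rewrite mulr_ge0 //; lra.
lra.
Qed.

Lemma adagrad_weight_itv (R : realFieldType) (D0 D1 : R) :
  0 <= D0 -> 0 < D1 -> forall G : R, 0 <= D0 / (D0 + D1 * G ^+ 2) <= 1.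
Proof.
move=> D0_ge0 D1_gt0 G; set W := D0 + _.
have D1G : 0 <= D1 * G ^+ 2 by rewrite mulr_ge0 ?sqr_ge0 // ltW.
have W_ge0 : 0 <= W by rewrite addr_ge0.
rewrite divr_ge0 //=.
have [->|Wn0] := eqVneq W 0; first by rewrite invr0 mulr0.
by rewrite ler_pdivrMr ?lt_def ?Wn0 // mul1r lerDl.
Qed.

(** * Euclidean geometry and the descent lemma *)

Definition dotp (R : realType) (n : nat) (u v : 'rV[R]_n) : R :=
  \sum_(i < n) u 0 i * v 0 i.

Lemma enorm_ge0 (R : realType) n (v : 'rV[R]_n) : 0 <= enorm v.
Proof. exact: sqrtr_ge0. Qed.

Lemma sqr_enorm (R : realType) n (v : 'rV[R]_n) : enorm v ^+ 2 = dotp v v.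
Proof.
rewrite /enorm sqr_sqrtr; last by apply: sumr_ge0 => i _; exact: sqr_ge0.
by apply: eq_bigr => i _; rewrite expr2.
Qed.

Lemma dotpC (R : realType) n (u v : 'rV[R]_n) : dotp u v = dotp v u.
Proof. by apply: eq_bigr => i _; rewrite mulrC. Qed.

Lemma dotpDl (R : realType) n (u v w : 'rV[R]_n) :
  dotp (u + v) w = dotp u w + dotp v w.
Proof. by rewrite -big_split; apply: eq_bigr => i _; rewrite mxE mulrDl. Qed.

Lemma dotpZl (R : realType) n a (u v : 'rV[R]_n) :
  dotp (a *: u) v = a * dotp u v.
Proof. by rewrite mulr_sumr; apply: eq_bigr => i _; rewrite mxE mulrA. Qed.

Lemma dotpDr (R : realType) n (u v w : 'rV[R]_n) :
  dotp w (u + v) = dotp w u + dotp w v.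
Proof. by rewrite !(dotpC w) dotpDl. Qed.

Lemma dotpZr (R : realType) n a (u v : 'rV[R]_n) :
  dotp u (a *: v) = a * dotp u v.
Proof. by rewrite !(dotpC u) dotpZl. Qed.

Lemma enormZ (R : realType) n a (v : 'rV[R]_n) : enorm (a *: v) = `|a| * enorm v.
Proof.
rewrite /enorm -sqrtr_sqr -sqrtrM ?sqr_ge0 // mulr_sumr; congr Num.sqrt.
by apply: eq_bigr => i _; rewrite mxE exprMn.
Qed.

Lemma enorm_eq0 (R : realType) n (v : 'rV[R]_n) : enorm v = 0 -> v = 0.
Proof.
move=> h; have : dotp v v = 0 by rewrite -sqr_enorm h expr0n.
move/eqP; rewrite psumr_eq0; last by move=> i _; rewrite -expr2 sqr_ge0.
move=> /allP h0; apply/rowP => i; rewrite mxE.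
by have := h0 i (mem_index_enum _); rewrite mulf_eq0 orbb => /eqP.
Qed.

(** Cauchy-Schwarz: once zero vectors are set apart, expand the square of
    [enorm v *: u - enorm u *: v]. *)
Lemma dotp_le (R : realType) n (u v : 'rV[R]_n) : dotp u v <= enorm u * enorm v.
Proof.
have [u0|un0] := eqVneq (enorm u) 0.
  rewrite u0 mul0r /dotp big1 // => i _.
  by rewrite (enorm_eq0 u0) mxE mul0r.
have [v0|vn0] := eqVneq (enorm v) 0.
  rewrite v0 mulr0 /dotp big1 // => i _.
  by rewrite (enorm_eq0 v0) mxE mulr0.
have up : 0 < enorm u by rewrite lt_def un0 enorm_ge0.
have vp : 0 < enorm v by rewrite lt_def vn0 enorm_ge0.
have : 0 <= dotp (enorm v *: u - enorm u *: v) (enorm v *: u - enorm u *: v).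
  by rewrite -sqr_enorm sqr_ge0.
rewrite -scaleN1r !(dotpDl, dotpDr, dotpZl, dotpZr) -!sqr_enorm (dotpC v u) => h.
have : 0 <= 2 * (enorm u * enorm v) * (enorm u * enorm v - dotp u v) by lra.
by rewrite pmulr_rge0 ?subr_ge0 // !mulr_gt0.
Qed.

Lemma normr_dotp_le (R : realType) n (u v : 'rV[R]_n) :
  `|dotp u v| <= enorm u * enorm v.
Proof.
rewrite ler_norml dotp_le andbT lerNl -mulN1r -dotpZl.
apply: le_trans (dotp_le _ _) _.
by rewrite enormZ normrN1 mul1r.
Qed.

Lemma ler_enormD (R : realType) n (u v : 'rV[R]_n) :
  enorm (u + v) <= enorm u + enorm v.
Proof.
rewrite -ler_sqr ?nnegrE ?addr_ge0 ?enorm_ge0 //.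
rewrite sqr_enorm !(dotpDl, dotpDr) -!sqr_enorm (dotpC v u) sqrrD.
by have := dotp_le u v; lra.
Qed.

Lemma ler_normr_enorm (R : realType) n (v : 'rV[R]_n) i : `|v 0 i| <= enorm v.
Proof.
rewrite -ler_sqr ?nnegrE ?enorm_ge0 // real_normK ?num_real // sqr_enorm /dotp.
rewrite (bigD1 i) //= -expr2 lerDl; apply: sumr_ge0 => j _.
by rewrite -expr2 sqr_ge0.
Qed.

Lemma derive_dotp_grad (R : realType) n (f : 'rV[R]_n -> R) (u h : 'rV[R]_n) :
  differentiable f u -> 'D_h f u = dotp (grad f u) h.
Proof.
move=> df; rewrite deriveE // {1}(row_sum_delta h) linear_sum.
apply: eq_bigr => i _.
by rewrite linearZ /= mxE deriveE // mulrC.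
Qed.

(** The sign of [L] follows from testing the Lipschitz bound on two points at positive distance,
    here a coordinate vector and the origin. *)
Lemma lipschitz_const_ge0 (R : realType) n (f : 'rV[R]_n -> R) (L : R) :
  (0 < n)%N ->
  (forall u v, enorm (grad f u - grad f v) <= L * enorm (u - v)) -> 0 <= L.
Proof.
move=> n0 hL; pose i := Ordinal n0.
have := hL (delta_mx 0 i) 0; rewrite subr0 => h.
have dn : 0 < enorm (delta_mx 0 i : 'rV[R]_n).
  apply: lt_le_trans (ler_normr_enorm _ i).
  by rewrite mxE !eqxx normr1 ltr01.
by rewrite -(pmulr_lge0 _ dn); apply: le_trans h; exact: enorm_ge0.
Qed.

Lemma descent (R : realType) n (f : 'rV[R]_n -> R) (L : R) :
  (forall u, differentiable f u) ->
  (forall u v, enorm (grad f u - grad f v) <= L * enorm (u - v)) ->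
  forall u h : 'rV[R]_n,
  f (u + h) <= f u + dotp (grad f u) h + L / 2 * enorm h ^+ 2.
Proof.
move=> df hL u h.
pose c := dotp (grad f u) h.
pose q := L / 2 * enorm h ^+ 2.
pose line (t : R) := u + t *: h.
have dl (t : R) : is_derive t 1 (f \o line) (dotp (grad f (line t)) h).
  have dline : is_diff t line ( *:%R^~ h).
    have := @is_diffD R R 'rV[R]_n (cst u) ( *:%R^~ h) 0 ( *:%R^~ h) t
      (is_diff_cst u t) (is_diff_scalel t h).
    by rewrite add0r.
  have d2 : differentiable f (line t) by exact: df.
  have d1 : differentiable line t by exact: ex_diff.
  have d3 : differentiable (f \o line) t by exact: differentiable_comp.
  apply: DeriveDef; first exact/derivable1_diffP.
  rewrite deriveE // diff_comp //= diff_val /= scale1r -deriveE //.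
  exact: derive_dotp_grad.
pose psi (t : R) := f (line t) - (t * c + t ^+ 2 * q).
have dpsi (t : R) : is_derive t 1 psi (dotp (grad f (line t)) h - (c + (t *+ 2) * q)).
  apply: is_deriveB; apply: is_derive_eq.
  rewrite /GRing.scale /=; ring.
have le10 : psi 1 <= psi 0.
  apply: (@ler0_derive1_nincr _ psi 0 1) => // [t|].
  - rewrite in_itv /= => /andP[t0 t1]; rewrite derive1E derive_val.
    have : dotp (grad f (line t) - grad f u) h <= L * (t * enorm h) * enorm h.
      apply: le_trans (dotp_le _ _) _; apply: ler_wpM2r; first exact: enorm_ge0.
      apply: le_trans (hL _ _) _.
      by rewrite /line addrC addKr enormZ gtr0_norm.
    rewrite -scaleN1r dotpDl dotpZl /q /c; lra.
  - apply: continuous_subspaceT => t; apply: differentiable_continuous.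
    by apply/derivable1_diffP; exact: ex_derive.
move: le10; rewrite /psi /line scale1r scale0r addr0 /q /c; lra.
Qed.

(** * Integration of real random variables and conditioning *)

(** The value 0 is allowed: there the inverse and the power of exponent [-1] are both 0 by
    convention. *)
Lemma measurable_inv_nneg d (T : measurableType d) (R : realType) (h : T -> R) :
  (forall x, 0 <= h x) -> measurable_fun setT h ->
  measurable_fun setT (fun x => (h x)^-1).
Proof.
move=> h0 mh.
have -> : (fun x => (h x)^-1) = (@powR R ^~ (-1)) \o h.
  by apply/funext => x /=; rewrite powR_inv1.
by apply: measurableT_comp => //; exact: measurable_powR.
Qed.

Lemma measurable_sqrt d (T : measurableType d) (R : realType) (h : T -> R) :
  measurable_fun setT h -> measurable_fun setT (fun x => Num.sqrt (h x)).
Proof.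
move=> mh; apply: (measurableT_comp _ mh).
by apply: continuous_measurable_fun; exact: sqrt_continuous.
Qed.

Definition rintegrable d (T : measurableType d) (R : realType)
  (P : probability T R) (X : T -> R) := P.-integrable setT (EFin \o X).

Lemma rintegrable_sum d (T : measurableType d) (R : realType)
    (P : probability T R) (I : Type) (s : seq I) (X : I -> T -> R) :
  (forall i, rintegrable P (X i)) ->
  rintegrable P (fun x => \sum_(i <- s) X i x).
Proof.
move=> iX; rewrite /rintegrable.
rewrite (_ : EFin \o _ = (fun x => \sum_(i <- s) (X i x)%:E)%E).
  by apply: integrable_sum => // i _; exact: iX.
by apply/funext => x /=; rewrite sumEFin.
Qed.

Lemma Rintegral_sum d (T : measurableType d) (R : realType)
    (P : probability T R) (I : Type) (s : seq I) (X : I -> T -> R) :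
  (forall i, rintegrable P (X i)) ->
  \int[P]_x (\sum_(i <- s) X i x) = \sum_(i <- s) \int[P]_x X i x.
Proof.
move=> iX; elim: s => [|i s IH].
  rewrite big_nil (@eq_Rintegral _ _ _ _ _ (cst 0)) ?Rintegral_cst ?mul0r //.
  by move=> x _; rewrite big_nil.
rewrite big_cons -IH -RintegralD //; [|exact: iX|exact: rintegrable_sum].
by apply: eq_Rintegral => x _; rewrite big_cons.
Qed.

Lemma rintegrableD d (T : measurableType d) (R : realType)
    (P : probability T R) (X Y : T -> R) :
  rintegrable P X -> rintegrable P Y -> rintegrable P (fun x => X x + Y x).
Proof. by move=> iX iY; exact: (integrableD measurableT iX iY). Qed.

Lemma rintegrableB d (T : measurableType d) (R : realType)
    (P : probability T R) (X Y : T -> R) :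
  rintegrable P X -> rintegrable P Y -> rintegrable P (fun x => X x - Y x).
Proof. by move=> iX iY; exact: (integrableB measurableT iX iY). Qed.

Lemma rintegrableZ d (T : measurableType d) (R : realType)
    (P : probability T R) (k : R) (X : T -> R) :
  rintegrable P X -> rintegrable P (fun x => k * X x).
Proof. by move=> iX; exact: (integrableZl measurableT k iX). Qed.

Lemma rintegrable_cst d (T : measurableType d) (R : realType)
    (P : probability T R) (k : R) : rintegrable P (fun=> k).
Proof. exact: finite_measure_integrable_cst. Qed.

Lemma Rintegral_prob_cst d (T : measurableType d) (R : realType)
    (P : probability T R) (k : R) : \int[P]_x k = k.
Proof.
rewrite Rintegral_cst //.
have -> : fine (P setT) = 1 by rewrite probability_setT.
by rewrite mulr1.
Qed.

Lemma rintegrable_le d (T : measurableType d) (R : realType)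
    (P : probability T R) (X Y : T -> R) : measurable_fun setT X ->
  (forall x, `|X x| <= Y x) -> rintegrable P Y -> rintegrable P X.
Proof.
move=> mX XY; apply: le_integrable => //; first exact/measurable_EFinP.
move=> x _ /=; rewrite lee_fin; apply: le_trans (XY x) _; exact: ler_norm.
Qed.

Lemma rintegrable_bounded d (T : measurableType d) (R : realType)
    (P : probability T R) (X : T -> R) (K : R) : measurable_fun setT X ->
  (forall x, `|X x| <= K) -> rintegrable P X.
Proof. by move=> mX XK; apply: rintegrable_le mX XK (rintegrable_cst P K). Qed.

Lemma rintegrable_bounded_mul d (T : measurableType d) (R : realType)
    (P : probability T R) (Z X : T -> R) (K : R) : measurable_fun setT Z ->
  (forall x, `|Z x| <= K) -> rintegrable P X ->
  rintegrable P (fun x => Z x * X x).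
Proof.
move=> mZ ZK iX; have mX := measurable_int _ iX.
apply: (@rintegrable_le _ _ _ _ _ (fun x => K * `|X x|)).
- by apply: measurable_funM => //; exact/measurable_EFinP.
- by move=> x; rewrite normrM ler_wpM2r.
- by apply: rintegrableZ; exact: integrable_norm.
Qed.

(** * Testing conditional expectations against bounded weights *)

Lemma sum_ltn_minn (N m : nat) : (\sum_(k < N) (k < m)%N)%N = minn N m.
Proof.
elim: N => [|N IH]; first by rewrite big_ord0 min0n.
by rewrite big_ord_recr /= IH; case: ltnP => h; rewrite /= ?addn1 ?addn0; lia.
Qed.

(** The thresholds [e * k.+1] below [z] number exactly the integer part of [z / e]. The sum thus
    rounds [z] down to a multiple of [e], using only indicators of superlevel sets. *)
Lemma staircase_approx (R : realType) (z e K : R) :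
  0 < e -> 0 <= z <= K ->
  `|z - \sum_(k < Num.truncn (K / e)) e * (e * k.+1%:R <= z)%R%:R| <= e.
Proof.
move=> e0 /andP[z0 zK].
have -> : \sum_(k < Num.truncn (K / e)) e * (e * k.+1%:R <= z)%R%:R
    = e * (Num.truncn (z / e))%:R.
  rewrite -mulr_sumr; congr (_ * _).
  under eq_bigr => k _ do rewrite mulrC -ler_pdivlMr // -truncn_gt_nat.
  rewrite -natr_sum sum_ltn_minn; congr (_%:R); apply/minn_idPr.
  by apply: le_truncn; rewrite ler_pM2r ?invr_gt0.
have /andP[] := truncn_itv (divr_ge0 z0 (ltW e0)).
set m := Num.truncn _; rewrite ler_pdivlMr // ltr_pdivrMr // -natr1 => h1 h2.
rewrite ler_norml; apply/andP; split. lra. lra.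
Qed.

(** Passes from sets of [G] to weights: [Z] is within [e] of a positive combination of indicators of
    its superlevel sets, which lie in [G]. The error is at most [e] times the mean of the absolute
    value of [X]. *)
Lemma Rintegral_weight_ge0 d (T : measurableType d) (R : realType)
    (P : probability T R) (G : set (set T)) (X Z : T -> R) (K : R) :
  G `<=` measurable -> rintegrable P X ->
  (forall A, G A -> 0 <= \int[P]_(x in A) X x) ->
  (preimage_set_system setT Z measurable `<=` G) -> (forall x, 0 <= Z x <= K) ->
  0 <= \int[P]_x (Z x * X x).
Proof.
move=> GM iX XG ZG ZK.
have mZ : measurable_fun setT Z.
  by move=> _ B mB; apply/GM/ZG; exists B.
have {}ZG c : G [set x | c <= Z x].
  apply: ZG; exists `[c, +oo[%classic; first exact: measurable_itv.
  by apply/seteqP; split=> x /=; rewrite in_itv /= andbT // => -[].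
have iZX : rintegrable P (fun x => Z x * X x).
  apply: (@rintegrable_bounded_mul _ _ _ _ _ _ K) => // x.
  by have /andP[? ?] := ZK x; rewrite ger0_norm.
have iaX : rintegrable P (fun x => `|X x|) by exact: integrable_norm.
have I0 : 0 <= \int[P]_x `|X x| by apply: Rintegral_ge0.
apply/ler_addgt0Pl => eps eps0.
(* The mesh makes the total error at most [eps]; adding 1 keeps the denominator positive. *)
pose e := eps / (\int[P]_x `|X x| + 1).
have e0 : 0 < e by rewrite divr_gt0 // ltr_wpDl.
pose A (k : nat) := [set x | e * k.+1%:R <= Z x].
pose Y (k : nat) (x : T) := e * (X \_ (A k)) x.
pose N := Num.truncn (K / e).
have mA k : measurable (A k) by apply: GM; exact: ZG.
have iA k : rintegrable P (X \_ (A k)).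
  rewrite /rintegrable -restrict_EFin; apply/(integrable_mkcond _ (mA k)).
  exact: integrableS iX.
have iY k : rintegrable P (Y k) by exact: rintegrableZ.
have Y0 : 0 <= \int[P]_x (\sum_(k < N) Y k x).
  rewrite Rintegral_sum //; apply: sumr_ge0 => k _.
  rewrite RintegralZl //; last exact: iA.
  apply: mulr_ge0; first exact: ltW.
  by rewrite -Rintegral_mkcond; apply/XG/ZG.
have iS : rintegrable P (fun x => \sum_(k < N) Y k x) by exact: rintegrable_sum.
have : \int[P]_x (\sum_(k < N) Y k x - e * `|X x|) <= \int[P]_x (Z x * X x).
  apply: le_Rintegral => //.
    by apply: rintegrableB => //; exact: rintegrableZ.
  move=> x _.
  have -> : \sum_(k < N) Y k x
      = (\sum_(k < N) e * (e * k.+1%:R <= Z x)%R%:R) * X x.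
    rewrite mulr_suml; apply: eq_bigr => k _; rewrite /Y patchE -mulrA.
    congr (_ * _); case: ifPn => [|] /=.
      by rewrite inE /A /= => ->; rewrite mul1r.
    by rewrite notin_setE /A /= => /negP/negbTE ->; rewrite mul0r.
  have := staircase_approx e0 (ZK x); rewrite -/N; set S := \sum_(k < N) _.
  move=> h; rewrite lerBlDr -lerBlDl -mulrBl; apply: le_trans (ler_norm _) _.
  by rewrite normrM ler_wpM2r // distrC.
rewrite RintegralB //; last exact: rintegrableZ.
rewrite RintegralZl // => h.
have : e * \int[P]_x `|X x| <= eps.
  by rewrite /e mulrAC ler_pdivrMr ?ltr_wpDl // ler_pM2l // lerDl.
lra.
Qed.

Lemma preimage_set_systemT (T U : Type) (Z : T -> U) (M : set (set U))
    (G : set (set T)) :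
  M setT -> preimage_set_system setT Z M `<=` G -> G setT.
Proof. by move=> MT ZG; apply: ZG; exists setT => //; rewrite setTI preimage_setT. Qed.

(** Shifting [Z] by [K] makes it nonnegative and leaves the integral unchanged, as [X] has mean 0.
    The previous lemma then applies to [X] and to its opposite. *)
Lemma Rintegral_weight_eq0 d (T : measurableType d) (R : realType)
    (P : probability T R) (G : set (set T)) (X Z : T -> R) (K : R) :
  G `<=` measurable -> rintegrable P X ->
  (forall A, G A -> \int[P]_(x in A) X x = 0) ->
  preimage_set_system setT Z measurable `<=` G -> (forall x, `|Z x| <= K) ->
  \int[P]_x (Z x * X x) = 0.
Proof.
move=> GM iX XG ZG ZK.
have GT : G setT := preimage_set_systemT measurableT ZG.
have mZ : measurable_fun setT Z.
  by move=> _ B mB; apply/GM/ZG; exists B.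
have ZKG : preimage_set_system setT (fun x => Z x + K) measurable `<=` G.
  move=> _ [B mB <-]; apply: ZG; exists ((fun z => z + K) @^-1` B) => //.
  rewrite -[X in measurable X]setTI.
  have := @measurable_funD _ _ R setT id (cst K) (@measurable_id _ _ _) (measurable_cst K).
  by move=> /(_ measurableT B mB).
have ZK0 x : 0 <= Z x + K <= 2 * K.
  by have := ZK x; rewrite ler_norml; lra.
have iZX : rintegrable P (fun x => Z x * X x) by exact: rintegrable_bounded_mul iX.
have E : \int[P]_x ((Z x + K) * X x) = \int[P]_x (Z x * X x).
  under eq_Rintegral do rewrite mulrDl.
  by rewrite RintegralD ?RintegralZl ?XG ?mulr0 ?addr0 //; exact: rintegrableZ.
have iNX : rintegrable P (fun x => - 1 * X x) by exact: rintegrableZ.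
have h1 : 0 <= \int[P]_x ((Z x + K) * X x).
  by apply: (@Rintegral_weight_ge0 _ _ _ _ G _ _ (2 * K)) => // A /XG ->.
have h2 : 0 <= \int[P]_x ((Z x + K) * (- 1 * X x)).
  apply: (@Rintegral_weight_ge0 _ _ _ _ G _ _ (2 * K)) => // A GA.
  rewrite RintegralZl ?XG ?mulr0 //; first exact: GM.
  by apply: integrableS iX => //; exact: GM.
move: h2; under eq_Rintegral do rewrite mulrCA.
rewrite RintegralZl //; last first.
  by apply: (@rintegrable_bounded_mul _ _ _ _ _ _ (2 * K)) => //;
    [exact: measurable_funD|move=> x; have /andP[? ?] := ZK0 x; rewrite ger0_norm].
by rewrite E in h1 *; lra.
Qed.

(** Taking out what is known, in integrated form: [X - Y] integrates to 0 over every set of [G]. *)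
Lemma cond_expectation_weight d (T : measurableType d) (R : realType)
    (P : probability T R) (G : set (set T)) (X Y Z : T -> R) (K : R) :
  G `<=` measurable ->
  is_cond_expectation P G (EFin \o X) (EFin \o Y) ->
  rintegrable P X -> rintegrable P Y ->
  preimage_set_system setT Z measurable `<=` G -> (forall x, `|Z x| <= K) ->
  \int[P]_x (Z x * X x) = \int[P]_x (Z x * Y x).
Proof.
move=> GM [_ _ XY] iX iY ZG ZK.
have mZ : measurable_fun setT Z.
  by move=> _ B mB; apply/GM/ZG; exists B.
apply/eqP; rewrite -subr_eq0 -RintegralB //;
  [|exact: rintegrable_bounded_mul mZ ZK _|exact: rintegrable_bounded_mul mZ ZK _].
under eq_Rintegral do rewrite -mulrBr.
apply/eqP; apply: (Rintegral_weight_eq0 GM _ _ ZG ZK); first exact: rintegrableB.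
move=> A GA; have mA := GM _ GA.
rewrite RintegralB //; [|exact: integrableS iX|exact: integrableS iY].
by rewrite /Rintegral -[X in fine X - _]XY // subrr.
Qed.

(** Integrability of [X] is a conclusion: its mean is that of [V], at most that of the bounded [W].
    The comparison over sets of [G] then extends to weights, applied to [W - X]. *)
Lemma cond_second_moment d (T : measurableType d) (R : realType)
    (P : probability T R) (G : set (set T)) (X W : T -> R) (V : T -> \bar R)
    (K : R) :
  G `<=` measurable ->
  is_cond_expectation P G (EFin \o X) V ->
  measurable_fun setT X -> (forall x, 0 <= X x) ->
  measurable_fun setT W -> (forall x, 0 <= W x <= K) ->
  {ae P, forall x, (V x <= (W x)%:E)%E} ->
  rintegrable P X /\
  forall (Z : T -> R) (k : R),
    preimage_set_system setT Z measurable `<=` G -> (forall x, 0 <= Z x <= k) ->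
    \int[P]_x (Z x * X x) <= \int[P]_x (Z x * W x).
Proof.
move=> GM [_ VG XV] mX X0 mW WK VW.
have mV : measurable_fun setT V.
  by move=> _ B mB; apply/GM/VG; exists B.
have GT : G setT := preimage_set_systemT measurableT VG.
have iW : rintegrable P W.
  apply: rintegrable_bounded mW _ => x.
  by have /andP[? ?] := WK x; rewrite ger0_norm //; eassumption.
have XW A : G A -> (\int[P]_(x in A) (X x)%:E <= \int[P]_(x in A) (W x)%:E)%E.
  move=> GA; have mA := GM _ GA; rewrite -XV // integralE.
  (* [V] may be negative or infinite at some points, so the comparison goes through its positive
     part, still almost surely at most [W]. *)
  apply: (@le_trans _ _ (\int[P]_(x in A) V^\+ x)%E).
    by rewrite geeDl // oppe_le0; apply: integral_ge0 => x _; exact: funeneg_ge0.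
  apply: ae_ge0_le_integral => //.
  - by apply: measurable_funTS; exact: measurable_funepos.
  - by move=> x _; rewrite lee_fin; have /andP[] := WK x.
  - by apply: measurable_funTS; exact/measurable_EFinP.
  - apply: filterS VW => x + _; rewrite /= funeposE => VWx.
    by rewrite ge_max VWx lee_fin; have /andP[] := WK x.
have iX : rintegrable P X.
  apply/integrableP; split; first exact/measurable_EFinP.
  under eq_integral do rewrite /= ger0_norm //.
  apply: le_lt_trans (XW _ GT) _; exact: integrable_lty iW.
split=> // Z k ZG Zk.
have mZ : measurable_fun setT Z.
  by move=> _ B mB; apply/GM/ZG; exists B.
have Zk' x : `|Z x| <= k by have /andP[? ?] := Zk x; rewrite ger0_norm.
rewrite -subr_ge0 -RintegralB //;
  [|exact: rintegrable_bounded_mul mZ Zk' _|exact: rintegrable_bounded_mul mZ Zk' _].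
under eq_Rintegral do rewrite -mulrBr.
apply: (Rintegral_weight_ge0 GM _ _ ZG Zk); first exact: rintegrableB.
move=> A GA; have mA := GM _ GA.
have iXA : P.-integrable A (EFin \o X) by exact: integrableS iX.
have iWA : P.-integrable A (EFin \o W) by exact: integrableS iW.
rewrite RintegralB // subr_ge0; apply: fine_le;
  [exact: integrable_fin_num|exact: integrable_fin_num|].
exact: XW.
Qed.

(** * Trajectories of AdaGrad-Norm *)

(** The family generating [past g t], named so that [g_sigma_algebraType] turns [Omega] into a
    measurable type for that sigma-algebra. Measurability with respect to the past is then ordinary
    measurability. *)
Definition past_generators (R : realType) (n : nat) (Omega : Type)
    (g : nat -> Omega -> 'rV[R]_n) (t : nat) : set (set Omega) :=
  [set A | exists s (i : 'I_n), (1 <= s < t)%N /\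
     preimage_set_system [set: Omega] (fun x => g s x 0 i) measurable A].

Lemma past_subset_measurable (R : realType) (n : nat) d (T : measurableType d)
    (g : nat -> T -> 'rV[R]_n) t :
  (forall s, (1 <= s)%N -> random_vector (g s)) -> past g t `<=` measurable.
Proof.
move=> gm; apply: smallest_sub; first exact: sigma_algebra_measurable.
by move=> A [s [i [/andP[s1 _] [B mB <-]]]]; exact: gm.
Qed.

Lemma measurable_pastP (R : realType) (n : nat) d (T : measurableType d)
    (g : nat -> T -> 'rV[R]_n) t (Z : T -> R) :
  @measurable_fun _ _ (g_sigma_algebraType (past_generators g t)) R setT Z <->
  preimage_set_system setT Z measurable `<=` past g t.
Proof.
split=> [mZ _ [B mB <-]|ZG _ B mB]; first exact: mZ.
by apply: ZG; exists B.
Qed.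

Lemma random_vector_past (R : realType) (n : nat) d (T : measurableType d)
    (g : nat -> T -> 'rV[R]_n) t s : (1 <= s < t)%N ->
  @random_vector R n _ (g_sigma_algebraType (past_generators g t)) (g s).
Proof.
move=> st i _ B mB; apply: sub_gen_smallest; exists s, i; split=> //.
by exists B.
Qed.

Lemma measurable_dotp (R : realType) (n : nat) d (T : measurableType d)
    (X Y : T -> 'rV[R]_n) : random_vector X -> random_vector Y ->
  measurable_fun setT (fun x => dotp (X x) (Y x)).
Proof. by move=> mX mY; apply: measurable_sum => i; exact: measurable_funM. Qed.

Lemma measurable_sqr_enorm (R : realType) (n : nat) d (T : measurableType d)
    (X : T -> 'rV[R]_n) : random_vector X ->
  measurable_fun setT (fun x => enorm (X x) ^+ 2).
Proof.
move=> mX; under eq_fun do rewrite sqr_enorm.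
exact: measurable_dotp.
Qed.

Lemma adagrad_nu_ge (R : realType) (n : nat) (T : Type) (eta nu0 : R) w1
    (g w : nat -> T -> 'rV[R]_n) (nu : nat -> T -> R) :
  adagrad_norm eta nu0 w1 g w nu -> forall i x, nu0 <= nu i x.
Proof.
move=> gen i x; have [nu_0 _ nu_S _] := gen x.
elim: i => [|i IH]; first by rewrite nu_0.
by rewrite nu_S //= (le_trans IH) // lerDl sqr_ge0.
Qed.

(** Only the gradients up to [m] are assumed measurable, so the lemma also applies with
    [past g m.+1] as the sigma-algebra. *)
Lemma measurable_adagrad_nu (R : realType) (n : nat) d (T : measurableType d)
    (eta nu0 : R) w1 (g w : nat -> T -> 'rV[R]_n) (nu : nat -> T -> R) m :
  adagrad_norm eta nu0 w1 g w nu ->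
  (forall s, (1 <= s <= m)%N -> random_vector (g s)) ->
  measurable_fun setT (nu m).
Proof.
move=> gen; elim: m => [|m IH] mg.
  rewrite (_ : nu 0%N = cst nu0) //.
  by apply/funext => x; have [] := gen x.
rewrite (_ : nu m.+1 = fun x => nu m x + enorm (g m.+1 x) ^+ 2); last first.
  by apply/funext => x; have [_ _ nu_S _] := gen x; rewrite nu_S.
apply: measurable_funD; last by apply: measurable_sqr_enorm; apply: mg; rewrite leqnn.
by apply: IH => s /andP[s1 sm]; apply: mg; rewrite s1 leqW.
Qed.

Section AdagradPath.
Variables (R : realType) (n : nat) (T : Type) (f : 'rV[R]_n -> R) (L : R).
Variables (eta nu0 : R) (w1 : 'rV[R]_n).
Variables (g w : nat -> T -> 'rV[R]_n) (nu : nat -> T -> R).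
Hypothesis f_diff : forall u : 'rV[R]_n, differentiable f u.
Hypothesis f_smooth : forall u v : 'rV[R]_n,
  enorm (grad f u - grad f v) <= L * enorm (u - v).
Hypothesis L_ge0 : 0 <= L.
Hypothesis eta_gt0 : 0 < eta.
Hypothesis nu0_gt0 : 0 < nu0.
Hypothesis gen : adagrad_norm eta nu0 w1 g w nu.

(** Indices are shifted: [i] is time [i + 1] for [w] and [g], whereas [r i] is the root of the
    conditioner just before that step. *)
Local Notation r i x := (Num.sqrt (nu i x)).
Local Notation G i x := (enorm (grad f (w i.+1 x))).

Lemma adagrad_nu_gt0 i x : 0 < nu i x.
Proof. exact: lt_le_trans nu0_gt0 (adagrad_nu_ge gen i x). Qed.

Lemma adagrad_root_gt0 i x : 0 < r i x.
Proof. by rewrite sqrtr_gt0 adagrad_nu_gt0. Qed.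

Lemma adagrad_root_ge i x : Num.sqrt nu0 <= r i x.
Proof. by apply: ler_wsqrtr; exact: adagrad_nu_ge gen _ _. Qed.

Lemma adagrad_root_sqr i x : r i x ^+ 2 = nu i x.
Proof. by rewrite sqr_sqrtr // ltW // adagrad_nu_gt0. Qed.

Lemma adagrad_root_step i x : r i.+1 x ^+ 2 = r i x ^+ 2 + enorm (g i.+1 x) ^+ 2.
Proof. by rewrite !adagrad_root_sqr; have [_ _ ->] := gen x. Qed.

Lemma adagrad_move i x :
  w i.+2 x - w i.+1 x = - (eta / r i.+1 x) *: g i.+1 x.
Proof. by have [_ _ _ ->] := gen x; rewrite // addrC addKr scaleNr. Qed.

Lemma adagrad_move_norm i x :
  enorm (w i.+2 x - w i.+1 x) = eta * (enorm (g i.+1 x) / r i.+1 x).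
Proof.
rewrite adagrad_move enormZ normrN gtr0_norm ?divr_gt0 ?adagrad_root_gt0 //.
by rewrite mulrAC mulrA.
Qed.

Lemma adagrad_grad_drift i x :
  G i.+1 x <= G i x + L * eta * (enorm (g i.+1 x) / r i.+1 x).
Proof.
rewrite -[in leLHS](subrK (grad f (w i.+1 x)) (grad f (w i.+2 x))).
apply: le_trans (ler_enormD _ _) _; rewrite addrC lerD2l.
by apply: le_trans (f_smooth _ _) _; rewrite adagrad_move_norm mulrA.
Qed.

(** Each step has length at most [eta], since the norm of the new gradient is at most the new root;
    hence [G] grows by at most [L * eta]. This deterministic bound is the source of
    integrability. *)
Lemma adagrad_grad_bounded i x : G i x <= enorm (grad f w1) + L * eta * i%:R.
Proof.
elim: i => [|i IH].
  by rewrite mulr0 addr0; have [_ -> _ _] := gen x.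
apply: le_trans (adagrad_grad_drift i x) _.
rewrite -natr1 mulrDr mulr1 addrA; apply: lerD => //.
rewrite -[leRHS]mulr1; apply: ler_wpM2l; first by rewrite mulr_ge0 // ltW.
rewrite ler_pdivrMr ?adagrad_root_gt0 // mul1r.
rewrite -ler_sqr ?nnegrE ?enorm_ge0 ?sqrtr_ge0 // adagrad_root_step lerDr.
exact: sqr_ge0.
Qed.

Lemma adagrad_descent i x :
  f (w i.+2 x) <= f (w i.+1 x)
    - eta * (dotp (grad f (w i.+1 x)) (g i.+1 x) / r i.+1 x)
    + L / 2 * eta ^+ 2 * (enorm (g i.+1 x) ^+ 2 / r i.+1 x ^+ 2).
Proof.
have := descent f_diff f_smooth (w i.+1 x) (w i.+2 x - w i.+1 x).
rewrite adagrad_move_norm adagrad_move addrC dotpZr.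
have -> : - (eta / r i.+1 x) *: g i.+1 x + w i.+1 x = w i.+2 x.
  by rewrite -adagrad_move subrK.
by move/le_trans; apply; rewrite !exprMn exprVn; lra.
Qed.

End AdagradPath.

(** * Conditional estimates along the trajectories *)

Section AdagradExpectation.
Variables (R : realType) (n : nat) (f : 'rV[R]_n -> R) (L : R).
Variables (disp : measure_display) (Omega : measurableType disp).
Variables (P : probability Omega R) (eta nu0 : R) (w1 : 'rV[R]_n).
Variables (g w : nat -> Omega -> 'rV[R]_n) (nu : nat -> Omega -> R).
Variables (D0 D1 : R).
Hypothesis f_smooth : forall u v : 'rV[R]_n,
  enorm (grad f u - grad f v) <= L * enorm (u - v).
Hypothesis L_ge0 : 0 <= L.
Hypothesis eta_gt0 : 0 < eta.
Hypothesis nu0_gt0 : 0 < nu0.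
Hypothesis D0_ge0 : 0 <= D0.
Hypothesis D1_gt0 : 0 < D1.
Hypothesis gen : adagrad_norm eta nu0 w1 g w nu.
Hypothesis g_random : forall t : nat, (1 <= t)%N -> random_vector (g t).
Hypothesis g_unbiased : forall t : nat, (1 <= t)%N -> forall i : 'I_n,
  is_cond_expectation P (past g t)
    (fun x => (g t x 0 i)%:E) (fun x => (grad f (w t x) 0 i)%:E).
Hypothesis g_affine_variance : forall t : nat, (1 <= t)%N ->
  exists2 V : Omega -> \bar R,
    is_cond_expectation P (past g t) (fun x => (enorm (g t x) ^+ 2)%:E) V
    & {ae P, forall x,
        (V x <= (D0 + D1 * enorm (grad f (w t x)) ^+ 2)%:E)%E}.

Let r i x := Num.sqrt (nu i x).
Let G i x := enorm (grad f (w i.+1 x)).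
Let p i x := enorm (g i.+1 x).
Let ip i x := dotp (grad f (w i.+1 x)) (g i.+1 x).
Let W i x := D0 + D1 * G i x ^+ 2.
Let pastType i := g_sigma_algebraType (past_generators g i.+1).

Let pastM i : past g i.+1 `<=` measurable.
Proof. exact: past_subset_measurable. Qed.

Let measurable_past i (Z : Omega -> R) :
  measurable_fun setT (Z : pastType i -> R) -> measurable_fun setT Z.
Proof. by move=> /measurable_pastP ZG _ B mB; apply: (pastM (i := i)); apply: ZG; exists B. Qed.

(** Measurability with respect to the past is read off the unbiasedness hypothesis: a version of a
    conditional expectation is measurable for the conditioning sigma-algebra. *)
Let grad_past i : random_vector (fun x : pastType i => grad f (w i.+1 x)).
Proof.
move=> j; apply/measurable_EFinP => _ B mB.
have [_ YG _] := g_unbiased (ltn0Sn i) j.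
by apply: YG; exists B.
Qed.

Let sqr_grad_past i : measurable_fun setT (fun x : pastType i => G i x ^+ 2).
Proof. exact: measurable_sqr_enorm. Qed.

Let root_past i : measurable_fun setT (r i : pastType i -> R).
Proof.
apply: measurable_sqrt.
apply: (@measurable_adagrad_nu _ _ _ (pastType i) _ _ _ _ _ _ _ gen) => s hs.
exact: random_vector_past.
Qed.

Let r_gt0 i x : 0 < r i x. Proof. exact: (adagrad_root_gt0 nu0_gt0 gen). Qed.
Let r_ge i x : Num.sqrt nu0 <= r i x. Proof. exact: (adagrad_root_ge gen). Qed.
Let sqrt_nu0_gt0 : 0 < Num.sqrt nu0. Proof. by rewrite sqrtr_gt0. Qed.

Let Vr_past i : measurable_fun setT (fun x : pastType i => (r i x)^-1).
Proof. by apply: measurable_inv_nneg => // x; exact: ltW. Qed.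

Let W_ge0 i x : 0 <= W i x.
Proof. by rewrite addr_ge0 // mulr_ge0 ?sqr_ge0 // ltW. Qed.

Let W_past i : measurable_fun setT (W i : pastType i -> R).
Proof. by apply: measurable_funD => //; exact: measurable_funM. Qed.

Let VW_past i : measurable_fun setT (fun x : pastType i => (W i x)^-1).
Proof. exact: measurable_inv_nneg. Qed.

(* This and the next identity survive the junk value 0 / 0 = 0, which occurs
   when [D0 = 0] and [G i x = 0]. *)
Let W_mul_div i x : G i x ^+ 2 / W i x * W i x = G i x ^+ 2.
Proof.
have [W0|Wn0] := eqVneq (W i x) 0; last by rewrite divfK.
rewrite W0 mulr0; have : D1 * G i x ^+ 2 = 0.
  have := mulr_ge0 (ltW D1_gt0) (sqr_ge0 (G i x)); move: D0_ge0 W0; rewrite /W.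
  lra.
by move/eqP; rewrite mulf_eq0 gt_eqF //= => /eqP.
Qed.

Let theta_mul i x : D0 / W i x * W i x = D0.
Proof.
have [W0|Wn0] := eqVneq (W i x) 0; last by rewrite divfK.
rewrite W0 mulr0; apply/esym/le_anti; rewrite D0_ge0 andbT.
by have := mulr_ge0 (ltW D1_gt0) (sqr_ge0 (G i x)); move: W0; rewrite /W; lra.
Qed.

Let theta_itv i x : 0 <= D0 / W i x <= 1.
Proof. exact: adagrad_weight_itv. Qed.

Let G_bounded i : exists2 K, 0 <= K & forall x, G i x ^+ 2 <= K.
Proof.
pose k := enorm (grad f w1) + L * eta * i%:R.
exists (k ^+ 2) => [|x]; first exact: sqr_ge0.
have h := adagrad_grad_bounded f_smooth L_ge0 eta_gt0 nu0_gt0 gen i x.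
by rewrite ler_sqr ?nnegrE ?enorm_ge0 //; apply: le_trans h; exact: enorm_ge0.
Qed.

Let second_moment i :
  rintegrable P (fun x => p i x ^+ 2) /\
  forall (Z : Omega -> R) (k : R),
    measurable_fun setT (Z : pastType i -> R) -> (forall x, 0 <= Z x <= k) ->
    \int[P]_x (Z x * p i x ^+ 2) <= \int[P]_x (Z x * W i x).
Proof.
have [V EV VW] := g_affine_variance (ltn0Sn i).
have [K K0 GK] := G_bounded i.
have [| | | |ip2 h] := @cond_second_moment _ _ _ P (past g i.+1) _ (W i) V
    (D0 + D1 * K) (@pastM i) EV _ _ _ _ VW.
- by apply: measurable_sqr_enorm; exact: g_random.
- by move=> x; exact: sqr_ge0.
- exact: measurable_past.
- by move=> x; rewrite W_ge0 /= /W lerD2l ler_pM2l.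
split=> // Z k /measurable_pastP; exact: h.
Qed.

Lemma measurable_adagrad_root i : measurable_fun setT (r i).
Proof. exact: measurable_past. Qed.

Lemma measurable_adagrad_sqr_grad i : measurable_fun setT (fun x => G i x ^+ 2).
Proof. exact: measurable_past. Qed.

Lemma rintegrable_sqr_gradient i : rintegrable P (fun x => p i x ^+ 2).
Proof. by have [] := second_moment i. Qed.

Lemma rintegrable_surrogate i : rintegrable P (fun x => G i x ^+ 2 / r i x).
Proof.
have [K K0 GK] := G_bounded i.
apply: (@rintegrable_bounded _ _ _ _ _ (K / Num.sqrt nu0)).
  by apply: measurable_past; exact: measurable_funM.
move=> x; rewrite ger0_norm ?divr_ge0 ?sqr_ge0 ?(ltW (r_gt0 _ _)) //.
by apply: ler_pM; rewrite ?sqr_ge0 ?invr_ge0 ?(ltW (r_gt0 _ _)) ?lef_pV2 ?posrE.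
Qed.

Let weighted_moment i (Z : Omega -> R) (k : R) :
  measurable_fun setT (Z : pastType i -> R) -> (forall x, 0 <= Z x <= k) ->
  rintegrable P (fun x => Z x * p i x ^+ 2).
Proof.
move=> mZ Zk; apply: (@rintegrable_bounded_mul _ _ _ _ _ _ k).
- exact: measurable_past mZ.
- by move=> x; have /andP[? ?] := Zk x; rewrite ger0_norm.
- exact: rintegrable_sqr_gradient.
Qed.

Let div_root_itv i (a b : R) x : 0 <= a <= b -> 0 <= a / r i x <= b / Num.sqrt nu0.
Proof.
move=> /andP[a0 ab]; rewrite divr_ge0 ?(ltW (r_gt0 _ _)) //=.
by apply: ler_pM; rewrite ?invr_ge0 ?(ltW (r_gt0 _ _)) ?lef_pV2 ?posrE.
Qed.

(** The factor of [p i x ^+ 2] depends on the past and is bounded, because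
    [D1 * G i x ^+ 2 <= W i x]. Replacing [p i x ^+ 2] by [W i x] cancels the denominator. *)
Lemma expectation_error_term i :
  rintegrable P (fun x => G i x ^+ 2 * p i x ^+ 2 / (W i x * r i x)) /\
  \int[P]_x (G i x ^+ 2 * p i x ^+ 2 / (W i x * r i x))
    <= \int[P]_x (G i x ^+ 2 / r i x).
Proof.
have -> : (fun x => G i x ^+ 2 * p i x ^+ 2 / (W i x * r i x))
    = (fun x => G i x ^+ 2 / W i x / r i x * p i x ^+ 2).
  by apply/funext => x; rewrite invfM; ring.
have mZ : measurable_fun setT ((fun x => G i x ^+ 2 / W i x / r i x) : pastType i -> R).
  by do 2![apply: measurable_funM => //].
have Zk x : 0 <= G i x ^+ 2 / W i x / r i x <= D1^-1 / Num.sqrt nu0.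
  apply: div_root_itv; rewrite divr_ge0 ?sqr_ge0 //=.
  have [->|Wn0] := eqVneq (W i x) 0; first by rewrite invr0 mulr0 invr_ge0 ltW.
  rewrite ler_pdivrMr ?lt_def ?Wn0 ?W_ge0 // mulrC ler_pdivlMr // mulrC lerDr //.
split; first exact: weighted_moment mZ Zk.
have [_ /(_ _ _ mZ Zk)] := second_moment i.
move=> /le_trans; apply; rewrite le_eqVlt; apply/orP; left; apply/eqP; apply: eq_Rintegral => x _.
by rewrite mulrAC W_mul_div.
Qed.

(** The weight [D0 / W] extracts exactly [D0] from the conditional bound [W]. *)
Lemma expectation_small_part i :
  rintegrable P (fun x => D0 / W i x * p i x ^+ 2) /\
  \int[P]_x (D0 / W i x * p i x ^+ 2) <= D0.
Proof.
have mZ : measurable_fun setT ((fun x => D0 / W i x) : pastType i -> R).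
  exact: measurable_funM.
split; first exact: weighted_moment mZ (theta_itv i).
have [_ /(_ _ _ mZ (theta_itv i))] := second_moment i.
move=> /le_trans; apply; under eq_Rintegral do rewrite theta_mul.
by rewrite Rintegral_prob_cst.
Qed.

(** The complementary weight extracts [D1 * G i x ^+ 2] from [W], so division by [r i] reproduces
    the surrogate. *)
Lemma expectation_large_part i :
  rintegrable P (fun x => (1 - D0 / W i x) * p i x ^+ 2 / r i x) /\
  \int[P]_x ((1 - D0 / W i x) * p i x ^+ 2 / r i x)
    <= D1 * \int[P]_x (G i x ^+ 2 / r i x).
Proof.
have -> : (fun x => (1 - D0 / W i x) * p i x ^+ 2 / r i x)
    = (fun x => (1 - D0 / W i x) / r i x * p i x ^+ 2).
  by apply/funext => x; rewrite mulrAC.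
have mZ : measurable_fun setT ((fun x => (1 - D0 / W i x) / r i x) : pastType i -> R).
  by apply: measurable_funM => //; apply: measurable_funB => //; exact: measurable_funM.
have Zk x : 0 <= (1 - D0 / W i x) / r i x <= 1 / Num.sqrt nu0.
  by apply: div_root_itv; have := theta_itv i x; lra.
split; first exact: weighted_moment mZ Zk.
have [_ /(_ _ _ mZ Zk)] := second_moment i.
move=> /le_trans; apply; rewrite -RintegralZl //; last exact: rintegrable_surrogate.
rewrite le_eqVlt; apply/orP; left; apply/eqP; apply: eq_Rintegral => x _.
rewrite mulrAC mulrBl mul1r theta_mul /W; ring.
Qed.

(** Coordinate by coordinate, [grad f (w i.+1 x) 0 j / r i x] is a bounded weight known from the
    past, and unbiasedness replaces [g] by the gradient. *)
Lemma expectation_inner_product i :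
  rintegrable P (fun x => ip i x / r i x) /\
  \int[P]_x (ip i x / r i x) = \int[P]_x (G i x ^+ 2 / r i x).
Proof.
have [K K0 GK] := G_bounded i.
have mgrad j : measurable_fun setT ((fun x => grad f (w i.+1 x) 0 j) : pastType i -> R).
  exact: grad_past.
have gradK j x : `|grad f (w i.+1 x) 0 j| <= Num.sqrt K.
  apply: le_trans (ler_normr_enorm _ _) _.
  rewrite -ler_sqr ?nnegrE ?enorm_ge0 ?sqrtr_ge0 // (sqr_sqrtr K0).
  exact: GK.
pose Z j x := grad f (w i.+1 x) 0 j / r i x.
have mZ j : measurable_fun setT (Z j : pastType i -> R) by exact: measurable_funM.
have ZK j x : `|Z j x| <= Num.sqrt K / Num.sqrt nu0.
  rewrite normrM normfV (gtr0_norm (r_gt0 _ _)).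
  by have /andP[] := @div_root_itv i _ _ x (introT andP (conj (normr_ge0 _) (gradK j x))).
have igj j : rintegrable P (fun x => g i.+1 x 0 j).
  apply: (@rintegrable_le _ _ _ _ _ (fun x => 1 + p i x ^+ 2)).
  - exact: g_random.
  - move=> x; have := ler_normr_enorm (g i.+1 x) j; rewrite -/(p i x).
    have := sqr_ge0 (p i x - 1); have := enorm_ge0 (g i.+1 x).
    rewrite -/(p i x); nra.
  - by apply: rintegrableD; [exact: rintegrable_cst|exact: rintegrable_sqr_gradient].
have igradj j : rintegrable P (fun x => grad f (w i.+1 x) 0 j).
  by apply: (@rintegrable_bounded _ _ _ P _ _ _ (gradK j)); exact: measurable_past.
have iZg j : rintegrable P (fun x => Z j x * g i.+1 x 0 j).
  by apply: (rintegrable_bounded_mul _ (ZK j)) => //; exact: measurable_past.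
have iZgrad j : rintegrable P (fun x => Z j x * grad f (w i.+1 x) 0 j).
  by apply: (rintegrable_bounded_mul _ (ZK j)) => //; exact: measurable_past.
have E1 : (fun x => ip i x / r i x) = (fun x => \sum_j Z j x * g i.+1 x 0 j).
  apply/funext => x; rewrite /ip /dotp mulr_suml; apply: eq_bigr => j _.
  by rewrite mulrAC.
have E2 : (fun x => G i x ^+ 2 / r i x)
    = (fun x => \sum_j Z j x * grad f (w i.+1 x) 0 j).
  apply/funext => x; rewrite /G sqr_enorm /dotp mulr_suml; apply: eq_bigr => j _.
  by rewrite mulrAC.
rewrite E1 E2; split; first exact: rintegrable_sum.
rewrite !Rintegral_sum //; apply: eq_bigr => j _.
apply: (cond_expectation_weight (@pastM i) (g_unbiased (ltn0Sn i) j) _ _ _ (ZK j)) => //.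
exact/measurable_pastP.
Qed.

Lemma rintegrable_adagrad_root i : rintegrable P (r i).
Proof.
have inu : rintegrable P (nu i).
  elim: i => [|i IH].
    rewrite (_ : nu 0%N = cst nu0); first exact: rintegrable_cst.
    by apply/funext => x; have [] := gen x.
  rewrite (_ : nu i.+1 = fun x => nu i x + p i x ^+ 2).
    by apply: rintegrableD => //; exact: rintegrable_sqr_gradient.
  by apply/funext => x; have [_ _ nu_S _] := gen x; rewrite nu_S.
apply: (@rintegrable_le _ _ _ _ _ (fun x => 1 + nu i x)).
- exact: measurable_adagrad_root.
- move=> x; rewrite (gtr0_norm (r_gt0 _ _)) -(adagrad_root_sqr nu0_gt0 gen).
  rewrite -/(r i x); have := sqr_ge0 (r i x - 1); nra.
- by apply: rintegrableD => //; exact: rintegrable_cst.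
Qed.

End AdagradExpectation.

(** * The high-probability bound *)

(** The left side has mean at least a quarter of that of the sum of the [s i], whence the factor 4.
    The logarithm is replaced by its tangent at the mean of [r], which stands for Jensen's
    inequality: the linear part has mean 1 and cancels the [-1]. *)
Lemma expected_surrogate_sum d (T : measurableType d) (R : realType)
    (P : probability T R) (m : nat) (u v s : nat -> T -> R) (r : T -> R)
    (c b : R) :
  (forall i, rintegrable P (u i)) -> (forall i, rintegrable P (v i)) ->
  (forall i, rintegrable P (s i)) -> rintegrable P r ->
  (forall i, \int[P]_x u i x = \int[P]_x s i x) ->
  (forall i, \int[P]_x v i x <= \int[P]_x s i x) ->
  (forall x, 0 < r x) -> 0 < \int[P]_x r x -> 0 <= b ->
  (forall x, \sum_(i < m) (u i x - 2^-1 * v i x - 4^-1 * s i x)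
             <= c + b * ln (r x ^+ 2)) ->
  \sum_(i < m) \int[P]_x s i x <= 4 * c + 8 * b * ln (\int[P]_x r x).
Proof.
move=> iu iv is_ ir us vs r0 X0 b0 H; set X := \int[P]_x r x.
have H' x : \sum_(i < m) (u i x - 2^-1 * v i x - 4^-1 * s i x)
    <= (c + 2 * b * (ln X - 1)) + 2 * b / X * r x.
  apply: le_trans (H x) _; rewrite lnXn //.
  have := ler_wpM2l b0 (ln_tangent (r0 x) X0); rewrite -mulr_natr.
  rewrite -/X; lra.
have it i : rintegrable P (fun x => u i x - 2^-1 * v i x - 4^-1 * s i x).
  by apply: rintegrableB; [apply: rintegrableB|]; rewrite //; exact: rintegrableZ.
have iR : rintegrable P (fun x => (c + 2 * b * (ln X - 1)) + 2 * b / X * r x).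
  by apply: rintegrableD; [exact: rintegrable_cst|exact: rintegrableZ].
have iS : rintegrable P
    (fun x => \sum_(i < m) (u i x - 2^-1 * v i x - 4^-1 * s i x)).
  exact: rintegrable_sum.
have := le_Rintegral measurableT iS iR (fun x _ => H' x).
rewrite Rintegral_sum // RintegralD //; [|exact: rintegrable_cst|exact: rintegrableZ].
rewrite Rintegral_prob_cst RintegralZl // -/X divfK ?gt_eqF //.
have : \sum_(i < m) 4^-1 * \int[P]_x s i x
    <= \sum_(i < m) \int[P]_x (u i x - 2^-1 * v i x - 4^-1 * s i x).
  apply: ler_sum => i _.
  rewrite RintegralB //; [|by apply: rintegrableB => //; exact: rintegrableZ|exact: rintegrableZ].
  rewrite RintegralB //; [|exact: iu|exact: rintegrableZ].
  rewrite (RintegralZl _ measurableT (iv i)) (RintegralZl _ measurableT (is_ i)).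
  by rewrite us; have := vs i; lra.
rewrite -mulr_sumr; lra.
Qed.

Lemma expected_root d (T : measurableType d) (R : realType)
    (P : probability T R) (m : nat) (s y z : nat -> T -> R) (r : T -> R)
    (nu0 D0 D1 k : R) :
  (forall i, rintegrable P (y i)) -> (forall i, rintegrable P (z i)) ->
  rintegrable P r ->
  (forall i, \int[P]_x y i x <= D0) ->
  (forall i, \int[P]_x z i x <= D1 * \int[P]_x s i x) ->
  0 < k ->
  (forall x, r x <= 2^-1 * ((nu0 + \sum_(i < m) y i x) / k + k)
                    + \sum_(i < m) z i x) ->
  \int[P]_x r x <= 2^-1 * ((nu0 + D0 * m%:R) / k + k)
                   + D1 * \sum_(i < m) \int[P]_x s i x.
Proof.
move=> iy iz ir yD zD k0 H.
have H' x : r x <= 2^-1 * (nu0 / k + k) + (2^-1 / k) * \sum_(i < m) y i x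
                   + \sum_(i < m) z i x.
  by apply: le_trans (H x) _; rewrite mulrDl; lra.
have iY : rintegrable P (fun x => \sum_(i < m) y i x) by exact: rintegrable_sum.
have iZ : rintegrable P (fun x => \sum_(i < m) z i x) by exact: rintegrable_sum.
have iY' := rintegrableZ (2^-1 / k) iY.
have iC := rintegrable_cst P (2^-1 * (nu0 / k + k)).
have := le_Rintegral measurableT ir (rintegrableD (rintegrableD iC iY') iZ)
  (fun x _ => H' x).
rewrite RintegralD //; last exact: rintegrableD.
rewrite RintegralD // Rintegral_prob_cst RintegralZl // !Rintegral_sum //.
have hZ : \sum_(i < m) \int[P]_x z i x <= D1 * \sum_(i < m) \int[P]_x s i x.
  by rewrite mulr_sumr; exact: ler_sum.
have hY : \sum_(i < m) \int[P]_x y i x <= D0 * m%:R.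
  apply: le_trans (_ : \sum_(i < m) D0 <= _); first exact: ler_sum.
  by rewrite sumr_const card_ord mulr_natr.
have k2 : 0 <= 2^-1 / k by rewrite divr_ge0 // ltW.
have := ler_wpM2l k2 hY; rewrite [in X in _ -> _ -> X]mulrDl.
lra.
Qed.

Lemma markov_real d (T : measurableType d) (R : realType)
    (P : probability T R) (Y : T -> R) (E : set T) (c : R) :
  rintegrable P Y -> (forall x, 0 <= Y x) -> measurable E ->
  (forall x, E x -> c <= Y x) -> c * fine (P E) <= \int[P]_x Y x.
Proof.
move=> iY Y0 mE EY.
have i1 : rintegrable P (\1_E : T -> R) by exact: integrable_indic.
have -> : fine (P E) = \int[P]_x (\1_E x).
  by rewrite /Rintegral integral_indic // setIT.
rewrite -RintegralZl //; apply: le_Rintegral => //.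
  exact: rintegrableZ.
move=> x _; rewrite indicE; have [|] := boolP (x \in E).
  by rewrite inE mulr1 => /EY.
by rewrite mulr0.
Qed.

(* Markov's inequality applied to the square root of the product, which costs
   only one factor [1 / delta]; the weighted arithmetic mean of [A] and [B]
   stands for that square root. *)
Lemma markov_product d (T : measurableType d) (R : realType)
    (P : probability T R) (A B : T -> R) (a b delta : R) :
  rintegrable P A -> rintegrable P B ->
  (forall x, 0 <= A x) -> (forall x, 0 <= B x) ->
  \int[P]_x A x <= a -> \int[P]_x B x <= b -> 0 <= a -> 0 < b -> 0 < delta ->
  fine (P [set x | a * b / delta ^+ 2 < A x * B x]) <= delta.
Proof.
move=> iA iB A0 B0 Aa Bb a0 b0 delta0.
set E := [set x | _].
have mA : measurable_fun setT A by apply/measurable_EFinP; exact: measurable_int iA.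
have mB : measurable_fun setT B by apply/measurable_EFinP; exact: measurable_int iB.
have mE : measurable E.
  rewrite -[E]setTI; apply: (@measurable_fun_ltr _ _ _ _ (cst _) (A \* B)) => //.
  exact: measurable_funM.
(* The weights below divide by the root of [a]. If [a = 0], then [A] vanishes almost surely and the
   event is null. *)
have [a00|an0] := eqVneq a 0.
  have IA0 : (\int[P]_x `|(A x)%:E| = 0)%E.
    under eq_integral do rewrite gee0_abs ?lee_fin //.
    rewrite -[LHS]fineK; last exact: integrable_fin_num.
    by congr EFin; apply/le_anti; rewrite -{1}a00 Aa Rintegral_ge0.
  have mEA : measurable_fun setT (EFin \o A) by exact/measurable_EFinP.
  have [N [mN N0 AN]] := (ae_eq_integral_abs P measurableT mEA).1 IA0.
  have -> : P E = 0%E.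
    apply: (subset_measure0 mE mN _ N0) => x Ex; apply: AN => /= /(_ I) [Ax0].
    by move: Ex; rewrite /E /= a00 Ax0 !mul0r ltxx.
  exact: ltW.
have ap : 0 < a by rewrite lt_def an0.
pose s := Num.sqrt a; pose t := Num.sqrt b.
have s0 : 0 < s by rewrite sqrtr_gt0.
have t0 : 0 < t by rewrite sqrtr_gt0.
have sa : s ^+ 2 = a by rewrite sqr_sqrtr.
have tb : t ^+ 2 = b by rewrite sqr_sqrtr // ltW.
(* The two coefficients have product [1 / 4], so [Y x ^+ 2 >= A x * B x]. They are balanced so that
   the mean of [Y] is at most [s * t], the root of [a * b]. *)
pose Y x := 2^-1 * (t / s) * A x + 2^-1 * (s / t) * B x.
have k1 : 0 <= 2^-1 * (t / s) by rewrite mulr_ge0 ?invr_ge0 // divr_ge0 ?ltW.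
have k2 : 0 <= 2^-1 * (s / t) by rewrite mulr_ge0 ?invr_ge0 // divr_ge0 ?ltW.
have Y0 x : 0 <= Y x by rewrite addr_ge0 // mulr_ge0.
have iY : rintegrable P Y by apply: rintegrableD; exact: rintegrableZ.
have EY x : E x -> s * t / delta <= Y x.
  move=> Ex; rewrite -ler_sqr ?nnegrE // ?divr_ge0 ?mulr_ge0 ?(ltW s0) ?(ltW t0) ?(ltW delta0) //.
  have -> : (s * t / delta) ^+ 2 = a * b / delta ^+ 2.
    by rewrite expr_div_n exprMn sa tb.
  apply: le_trans (ltW Ex) _.
  rewrite -subr_ge0.
  have -> : Y x ^+ 2 - A x * B x = (2^-1 * (t / s) * A x - 2^-1 * (s / t) * B x) ^+ 2.
    by rewrite /Y; field; rewrite !gt_eqF.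
  exact: sqr_ge0.
have := markov_real iY Y0 mE EY.
have -> : \int[P]_x Y x = 2^-1 * (t / s) * \int[P]_x A x + 2^-1 * (s / t) * \int[P]_x B x.
  rewrite RintegralD //; [|exact: rintegrableZ|exact: rintegrableZ].
  by rewrite !RintegralZl.
have h1 := ler_wpM2l k1 Aa.
have h2 := ler_wpM2l k2 Bb.
have E1 : 2^-1 * (t / s) * a + 2^-1 * (s / t) * b = s * t.
  by rewrite -sa -tb; field; rewrite !gt_eqF.
move=> h3.
have : s * t / delta * fine (P E) <= s * t by lra.
rewrite mulrAC ler_pdivrMr // mulrC -subr_ge0.
by rewrite (mulrC (fine _)) -mulrBr pmulr_rge0 ?mulr_gt0 // subr_ge0.
Qed.

Lemma measurable_bigmin d (T : measurableType d) (R : realType)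
    (F : nat -> T -> R) (z : T -> R) (s : seq nat) :
  measurable_fun setT z -> (forall i, measurable_fun setT (F i)) ->
  measurable_fun setT (fun x => \big[Num.min/z x]_(i <- s) F i x).
Proof.
move=> mz mF; elim: s => [|i s IH].
  by under eq_fun do rewrite big_nil.
by under eq_fun do rewrite big_cons; exact: measurable_minr.
Qed.

Theorem theorem2 (R : realType) (d : nat) (hd : (1 <= d)%N)
    (f : 'rV[R]_d -> R)
    (f_diff : forall u : 'rV[R]_d, differentiable f u)
    (f_bounded_below : has_lbound (range f))
    (L : R)
    (f_smooth : forall u v : 'rV[R]_d,
       enorm (grad f u - grad f v) <= L * enorm (u - v))
    (disp : measure_display) (Omega : measurableType disp)
    (P : probability Omega R)
    (eta : R) (eta_gt0 : 0 < eta)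
    (w1 : 'rV[R]_d) (nu0 : R) (nu0_gt0 : 0 < nu0)
    (g w : nat -> Omega -> 'rV[R]_d) (nu : nat -> Omega -> R)
    (g_random : forall t : nat, (1 <= t)%N -> random_vector (g t))
    (gen : adagrad_norm eta nu0 w1 g w nu)
    (g_unbiased : forall t : nat, (1 <= t)%N -> forall i : 'I_d,
       is_cond_expectation P (past g t)
         (fun x => (g t x 0 i)%:E) (fun x => (grad f (w t x) 0 i)%:E))
    (D0 D1 : R) (D0_ge0 : 0 <= D0) (D1_gt0 : 0 < D1)
    (g_affine_variance : forall t : nat, (1 <= t)%N ->
       exists2 V : Omega -> \bar R,
         is_cond_expectation P (past g t)
           (fun x => (enorm (g t x) ^+ 2)%:E) V
         & {ae P, forall x,
             (V x <= (D0 + D1 * enorm (grad f (w t x)) ^+ 2)%:E)%E})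
    (delta : R) (delta_in : 0 < delta < 1)
    (T : nat) (T_ge1 : (1 <= T)%N) :
  let fstar : R := inf (range f) in
  let w0 : 'rV[R]_d := w1 in
  let C1 : R := 4 / eta *
    (f w1 - fstar
     + eta * D1 / 2 * (enorm (grad f w0) ^+ 2 / Num.sqrt nu0)
     + (2 * eta * (L * eta * D1) ^+ 2 + eta * D1 * (L * eta) ^+ 2
        + eta / 2 * D0) * (1 / Num.sqrt nu0)
     - L / 2 * eta ^+ 2 * ln nu0) in
  let C2 : R := 2 * L * eta in
  let C3 : R := 4 * D1 * C1 + 48 * C2 * D1 * ln (4 * C2 * D1 + expR 1)
                + 2 * Num.sqrt nu0 in
  let logT : R := ln (2 * Num.sqrt (2 * D0 * T%:R) + C3) in
  let bound : R :=
    2 * Num.sqrt (2 * D0) * (2 * C2 * logT + C1) / (Num.sqrt T%:R * delta ^+ 2)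
    + C3 * (C1 + 2 * C2 * logT) / (T%:R * delta ^+ 2) in
  let min_grad (x : Omega) : R :=
    \big[Num.min/enorm (grad f (w 1%N x)) ^+ 2]_(1 <= t < T.+1)
       enorm (grad f (w t x)) ^+ 2 in
  ((1 - delta)%:E <= P [set x | (min_grad x <= bound)%R])%E.
Proof.
pose fstar : R := inf (range f).
pose w0 : 'rV[R]_d := w1.
pose C1 : R := 4 / eta *
    (f w1 - fstar
     + eta * D1 / 2 * (enorm (grad f w0) ^+ 2 / Num.sqrt nu0)
     + (2 * eta * (L * eta * D1) ^+ 2 + eta * D1 * (L * eta) ^+ 2
        + eta / 2 * D0) * (1 / Num.sqrt nu0)
     - L / 2 * eta ^+ 2 * ln nu0).
pose C2 : R := 2 * L * eta.
pose C3 : R := 4 * D1 * C1 + 48 * C2 * D1 * ln (4 * C2 * D1 + expR 1)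
                + 2 * Num.sqrt nu0.
pose logT : R := ln (2 * Num.sqrt (2 * D0 * T%:R) + C3).
pose bound : R :=
    2 * Num.sqrt (2 * D0) * (2 * C2 * logT + C1) / (Num.sqrt T%:R * delta ^+ 2)
    + C3 * (C1 + 2 * C2 * logT) / (T%:R * delta ^+ 2).
pose min_grad (x : Omega) : R :=
    \big[Num.min/enorm (grad f (w 1%N x)) ^+ 2]_(1 <= t < T.+1)
       enorm (grad f (w t x)) ^+ 2.
change (is_true ((1 - delta)%:E <= P [set x | (min_grad x <= bound)%R])%E).
have [delta_gt0 _] := andP delta_in.
have L_ge0 : 0 <= L by exact: lipschitz_const_ge0 hd f_smooth.
pose r i x := Num.sqrt (nu i x).
pose G i x := enorm (grad f (w i.+1 x)).
pose p i x := enorm (g i.+1 x).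
pose ip i x := dotp (grad f (w i.+1 x)) (g i.+1 x).
pose W i x := D0 + D1 * G i x ^+ 2.
pose s i x := G i x ^+ 2 / r i x.
have r_gt0 i x : 0 < r i x by exact: (adagrad_root_gt0 nu0_gt0 gen).
have r_step i x : r i.+1 x ^+ 2 = r i x ^+ 2 + p i x ^+ 2.
  exact: (adagrad_root_step nu0_gt0 gen).
have r0E x : r 0%N x = Num.sqrt nu0 by rewrite /r; have [->] := gen x.
have sqrt_nu0_gt0 : 0 < Num.sqrt nu0 by rewrite sqrtr_gt0.
have is_ i : rintegrable P (s i).
  exact: (rintegrable_surrogate f_smooth L_ge0 eta_gt0 nu0_gt0 gen g_random
    g_unbiased).
have iv i : rintegrable P (fun x => G i x ^+ 2 * p i x ^+ 2 / (W i x * r i x)) /\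
    \int[P]_x (G i x ^+ 2 * p i x ^+ 2 / (W i x * r i x)) <= \int[P]_x s i x.
  exact: (expectation_error_term f_smooth L_ge0 eta_gt0 nu0_gt0 D0_ge0 D1_gt0
    gen g_random g_unbiased g_affine_variance).
have iy i : rintegrable P (fun x => D0 / W i x * p i x ^+ 2) /\
    \int[P]_x (D0 / W i x * p i x ^+ 2) <= D0.
  exact: (expectation_small_part f_smooth L_ge0 eta_gt0 nu0_gt0 D0_ge0 D1_gt0
    gen g_random g_unbiased g_affine_variance).
have iz i : rintegrable P (fun x => (1 - D0 / W i x) * p i x ^+ 2 / r i x) /\
    \int[P]_x ((1 - D0 / W i x) * p i x ^+ 2 / r i x) <= D1 * \int[P]_x s i x.
  exact: (expectation_large_part f_smooth L_ge0 eta_gt0 nu0_gt0 D0_ge0 D1_gt0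
    gen g_random g_unbiased g_affine_variance).
have iu i : rintegrable P (fun x => ip i x / r i x) /\
    \int[P]_x (ip i x / r i x) = \int[P]_x s i x.
  exact: (expectation_inner_product f_smooth L_ge0 eta_gt0 nu0_gt0 D0_ge0 D1_gt0
    gen g_random g_unbiased g_affine_variance).
have ir i : rintegrable P (r i).
  exact: (rintegrable_adagrad_root f_smooth L_ge0 eta_gt0 nu0_gt0 D0_ge0 D1_gt0
    gen g_random g_unbiased g_affine_variance).
have mG i : measurable_fun setT (fun x => G i x ^+ 2).
  exact: (measurable_adagrad_sqr_grad g_random g_unbiased).
have s_ge0 i x : 0 <= s i x by exact: divr_ge0 (sqr_ge0 _) (ltW (r_gt0 i x)).

(* Mutual bounds on the mean of [r T] and of the surrogate sum *)
pose X := \int[P]_x r T x; pose B0 := \sum_(i < T) \int[P]_x s i x.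
have X_gt0 : 0 < X.
  apply: lt_le_trans sqrt_nu0_gt0 _; rewrite -[leLHS](Rintegral_prob_cst P).
  apply: (le_Rintegral measurableT (rintegrable_cst P _) (ir T)) => x _.
  exact: (adagrad_root_ge gen).
have B0_ge0 : 0 <= B0.
  by apply: sumr_ge0 => i _; exact: Rintegral_ge0.
have B0_le : B0 <= C1 + 2 * C2 * ln X.
  have b0 : 0 <= L * eta / 2 by rewrite divr_ge0 // mulr_ge0 // ltW.
  (* The constant of the pathwise bound, with the last value of [f] replaced by [fstar]. Its
     quadruple differs from [C1] by the nonnegative [4 * D1 * (L * eta) ^+ 2 / Num.sqrt nu0]. *)
  pose c := (f w1 - fstar) / eta - L * eta / 2 * ln nu0
    + D0 / 2 * (1 / Num.sqrt nu0) + D1 / 2 * (enorm (grad f w1) ^+ 2 / Num.sqrt nu0)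
    + 2 * (L * eta * D1) ^+ 2 * (1 / Num.sqrt nu0).
  have := @expected_surrogate_sum _ _ _ P T _ _ s (r T) c _
    (fun i => (iu i).1) (fun i => (iv i).1) is_ (ir T)
    (fun i => (iu i).2) (fun i => (iv i).2) (r_gt0 T) X_gt0 b0.
  have cC1 : 4 * c <= C1.
    have : 0 <= 4 * (D1 * (L * eta) ^+ 2 * (1 / Num.sqrt nu0)).
      rewrite !mulr_ge0 ?sqr_ge0 ?divr_ge0 ?(ltW sqrt_nu0_gt0) //; exact: ltW.
    move=> h; rewrite -subr_ge0.
    have -> : C1 - 4 * c = 4 * (D1 * (L * eta) ^+ 2 * (1 / Num.sqrt nu0)).
      by rewrite /C1 /c /w0; field; rewrite !gt_eqF.
    by [].
  move=> H; apply: le_trans (H _) _; last by rewrite -/X /C2; lra.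
  move=> x; case: T T_ge1 {X X_gt0 B0 B0_ge0 H logT bound min_grad} => // m _.
  have := @adagrad_pathwise R eta L D0 D1 (r^~ x) (G^~ x) (p^~ x) (ip^~ x)
    (fun i => f (w i.+1 x)) eta_gt0 L_ge0 D0_ge0 D1_gt0 (r_gt0^~ x)
    (fun i => enorm_ge0 _) (fun i => enorm_ge0 _) (r_step^~ x)
    (fun i => normr_dotp_le _ _)
    (fun i => adagrad_grad_drift f_smooth eta_gt0 nu0_gt0 gen i x)
    (fun i => adagrad_descent f_diff f_smooth eta_gt0 nu0_gt0 gen i x) m.
  move=> /le_trans; apply; rewrite /= r0E (sqr_sqrtr (ltW nu0_gt0)).
  have [_ w1E _ _] := gen x; rewrite /G w1E.
  have hf : fstar <= f (w m.+2 x) by apply: ge_inf => //; exists (w m.+2 x).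
  have : (f w1 - f (w m.+2 x)) / eta <= (f w1 - fstar) / eta.
    by rewrite ler_pM2r ?invr_gt0 // lerB.
  rewrite /c; lra.
have X_le : X <= Num.sqrt nu0 + Num.sqrt (2 * D0 * T%:R) + D1 * B0.
  (* This choice minimizes the Young bound, which then equals [k]. *)
  pose k := Num.sqrt (nu0 + D0 * T%:R).
  have DT0 : 0 <= D0 * T%:R by rewrite mulr_ge0.
  have k_gt0 : 0 < k by rewrite sqrtr_gt0 ltr_wpDr.
  have k_sqr : k ^+ 2 = nu0 + D0 * T%:R by rewrite sqr_sqrtr // addr_ge0 // ltW.
  have := @expected_root _ _ _ P T s _ _ (r T) nu0 D0 D1 k
    (fun i => (iy i).1) (fun i => (iz i).1) (ir T)
    (fun i => (iy i).2) (fun i => (iz i).2) k_gt0.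
  have k_le : k <= Num.sqrt nu0 + Num.sqrt (2 * D0 * T%:R).
    rewrite -ler_sqr ?nnegrE ?addr_ge0 ?sqrtr_ge0 // k_sqr sqrrD.
    rewrite !sqr_sqrtr ?(ltW nu0_gt0) -?mulrA ?mulr_ge0 //.
    have := mulr_ge0 (sqrtr_ge0 nu0) (sqrtr_ge0 (2 * (D0 * T%:R))); lra.
  move=> H; apply: le_trans (H _) _.
    move=> x; apply: le_trans (@conditioner_pathwise R (r^~ x) (p^~ x)
      (fun i => D0 / W i x) k k_gt0 (r_gt0^~ x) (r_step^~ x) _ T) _.
      move=> i; exact: (adagrad_weight_itv D0_ge0 D1_gt0 (G i x)).
    by rewrite r0E sqr_sqrtr // ltW.
  by rewrite lerD2r -k_sqr expr2 mulfK ?gt_eqF //; lra.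
pose M := 2 * Num.sqrt (2 * D0 * T%:R) + C3.
have C2_ge0 : 0 <= C2 by rewrite /C2 !mulr_ge0 // ltW.
have X_M : X <= M.
  have a0 : 0 <= 4 * C2 * D1 by rewrite !mulr_ge0 // ltW.
  (* [D1 * (C1 + 2 * C2 * ln X)] dominates [D1 * B0] and is therefore nonnegative, so it may be
     doubled; this gives the coefficients that lead to [C3]. *)
  have h : X <= Num.sqrt nu0 + Num.sqrt (2 * D0 * T%:R) + 2 * D1 * C1
                + 4 * C2 * D1 * ln X.
    have h1 := ler_wpM2l (ltW D1_gt0) B0_le.
    have h2 := mulr_ge0 (ltW D1_gt0) B0_ge0.
    lra.
  have := le_of_log_growth X_gt0 a0 h; rewrite /M /C3; lra.
have M_gt0 : 0 < M by exact: lt_le_trans X_M.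
pose B := C1 + 2 * C2 * logT.
have B0_B : B0 <= B.
  apply: le_trans B0_le _; rewrite lerD2l; apply: ler_wpM2l.
    by rewrite mulr_ge0.
  by rewrite ler_ln ?posrE.
have boundE : bound = B * M / delta ^+ 2 / T%:R.
  have T_gt0 : 0 < T%:R :> R by rewrite ltr0n.
  (* With [t] for the root of [T], the two fractions of the bound combine by pure field algebra. *)
  have bound_alg (t q l c1 c2 c3 dl : R) : t != 0 -> dl != 0 ->
      2 * q * (2 * c2 * l + c1) / (t * dl ^+ 2)
        + c3 * (c1 + 2 * c2 * l) / (t ^+ 2 * dl ^+ 2)
      = (c1 + 2 * c2 * l) * (2 * (q * t) + c3) / dl ^+ 2 / t ^+ 2.
    by move=> t0 dl0; field; rewrite t0 dl0.
  rewrite /B /M sqrtrM ?mulr_ge0 //.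
  have := bound_alg (Num.sqrt T%:R) (Num.sqrt (2 * D0)) logT C1 C2 C3 delta.
  by rewrite (sqr_sqrtr (ltW T_gt0)); apply; rewrite gt_eqF // sqrtr_gt0.

(* From the two means to the probability of the event *)
pose S x := \sum_(i < T) s i x.
have iS : rintegrable P S by exact: rintegrable_sum.
have ES : \int[P]_x S x <= B by rewrite Rintegral_sum.
have S_ge0 x : 0 <= S x by apply: sumr_ge0.
have := markov_product iS (ir T) S_ge0 (fun x => ltW (r_gt0 T x)) ES X_M
  (le_trans B0_ge0 B0_B) M_gt0 delta_gt0.
set E := [set x | _] => PE.
have mE : measurable E.
  rewrite -[E]setTI; apply: (@measurable_fun_ltr _ _ _ _ (cst _) (S \* r T)) => //.
  by apply: measurable_funM; apply/measurable_EFinP;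
    [exact: measurable_int iS|exact: measurable_int (ir T)].
have mgood : measurable [set x | min_grad x <= bound].
  rewrite -[X in measurable X]setTI.
  apply: (@measurable_fun_ler _ _ _ _ min_grad (cst _)) => //.
  rewrite /min_grad; under eq_fun do rewrite big_add1.
  by apply: measurable_bigmin => // i; exact: mG.
have r_mono x i : (i <= T)%N -> r i x <= r T x.
  move=> iT; rewrite -(subnK iT); elim: (T - i)%N => // m IH.
  apply: le_trans IH _; rewrite addSn.
  by rewrite -ler_sqr ?nnegrE ?(ltW (r_gt0 _ _)) // r_step lerDl sqr_ge0.
(* Outside [E] the product of [S] and [r T] is small. Each [G i x ^+ 2] equals [s i x * r i x], at
   most [s i x * r T x], so [T] times the minimum is at most that product. *)
have good : ~` E `<=` [set x | min_grad x <= bound].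
  move=> x /= /negP; rewrite -leNgt => Ex.
  rewrite boundE ler_pdivlMr ?ltr0n //; apply: le_trans Ex.
  rewrite mulr_suml mulr_natr -[X in _ *+ X]card_ord -sumr_const.
  apply: ler_sum => i _.
  apply: (@le_trans _ _ (G i x ^+ 2)).
    rewrite /min_grad big_add1 /=.
    by apply: (@ge_bigmin_seq _ _ _ _ _ (i : nat)) => //; rewrite mem_index_iota /=.
  rewrite /s mulrAC ler_pdivlMr //; apply: ler_wpM2l; first exact: sqr_ge0.
  by apply: r_mono; exact: ltnW.
apply: (@le_trans _ _ (P (~` E))); last first.
  by apply: le_measure good; rewrite inE //; exact: measurableC.
rewrite probability_setC // -[P E]fineK; last exact: fin_num_measure.
by rewrite -EFinB lee_fin lerB.
Qed.
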